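(* Let $0<p\le\frac12$. Suppose the collision kernel satisfies the Assumption stated in the context with $\eta\ge1+p$. Let $F_0\in\mathcal B_1^+(\mathbb R_{\ge0})$ with mass $N=N(F_0)$ and energy $E=E(F_0)$ satisfy $M_{-p}(F_0)<\infty$, and let $F_t$ be a conservative measure-valued isotropic solution on $[0,\infty)$ with initial datum $F_0$. Then $M_{-p}(F_t)<\infty$ for all $t>0$; more precisely $$M_{-p}(F_t)\le(at+M_{-p}(F_0))e^{bt}\qquad\forall\,t\ge0,$$ where $a=8^2b_0^2N^{\frac32+p}E^{\frac12-p}+8^{2+\eta}b_0^2N^3$ and $b=8^{3+\eta}b_0^2N^2(1+q_1)$.
   Context: Notation. $\mathcal B_1^+(\mathbb R_{\ge0})$: nonnegative Borel measures $F$ on $[0,\infty)$ with $\int(1+x)dF<\infty$. $M_q(F)=\int x^q\,dF(x)$ for $q\in\mathbb R$ (with $0^q=\infty$ for $q<0$, $\infty\cdot0=0$); $N=M_0$, $E=M_1$. $C^{1,1}_b(\mathbb R_{\ge0})$: $C^1_b$ functions with Lipschitz derivative. Kernel. $\hat\phi:[0,\infty)\to\mathbb R$ continuous bounded, $\Phi(r,\rho)=(\hat\phi(r)+\hat\phi(\rho))^2$, $x_*=(y+z-x)_+$. If $x_*xyz>0$, $W(x,y,z)=\frac{1}{4\pi\sqrt{xyz}}\int_{|\sqrt x-\sqrt y|\vee|\sqrt{x_*}-\sqrt z|}^{(\sqrt x+\sqrt y)\wedge(\sqrt{x_*}+\sqrt z)}ds\int_0^{2\pi}\Phi(\sqrt2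 s,\sqrt2 Y_* )d\theta$ with $Y_*=\big|\sqrt{(z-\frac{(x-y+s^2)^2}{4s^2})_+}+e^{i\theta}\sqrt{(x-\frac{(x-y+s^2)^2}{4s^2})_+}\big|$ ($s>0$), $Y_*=0$ ($s=0$). Otherwise $W(0,y,z)=\Phi(\sqrt{2y},\sqrt{2z})/\sqrt{yz}$ ($y,z>0$), $W(x,0,z)=\Phi(\sqrt{2x},\sqrt{2(z-x)})/\sqrt{xz}$ ($z>x>0$), $W(x,y,0)=\Phi(\sqrt{2(y-x)},\sqrt{2x})/\sqrt{xy}$ ($y>x>0$), $W=0$ otherwise. $\mathcal K[\varphi]=W(\varphi(x)+\varphi(x_* )-\varphi(y)-\varphi(z))$, $\mathcal J[\varphi](y,z)=\frac12\int_0^{y+z}\mathcal K[\varphi](x,y,z)\sqrt x\,dx$. Solutions. $\{F_t\}_{t\ge0}\subset\mathcal B_1^+$ is a conservative measure-valued isotropic solution with initial datum $F_0$ if $N(F_t),E(F_t)$ are constant, $t\mapsto\int\varphi\,dF_t\in C^1([0,\infty))$ for all $\varphi\in C^{1,1}_b$, and $\frac{d}{dt}\int\varphi\,dF_t=\int\mathcal J[\varphi]\,d(F_t\otimes F_t)+\int\mathcal K[\varphi]\,d(F_t\otimes F_t\otimes F_t)$ for all $t\ge0$. Assumption. $\hat\phi$ continuous on $[0,\infty)$; constants $b_0>0,\eta\ge1$ with $0\le\hat\phi(r)\le b_0\frac{r^\eta}{1+r^\eta}$ for all $r\ge0$; there is $k\in C^1([1,\sqrt2])$, $k(1)=1$,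 with $\hat\phi(ar)\le k(a)\hat\phi(r)$ for all $r>0$, $1<a\le\sqrt2$. $q_1=\max_{x\in[1,\sqrt2]}\max\{2k(x)k'(x),0\}$. *)

(* Defs.v *)
From mathcomp Require Import all_boot all_order all_algebra.
From mathcomp Require Import all_classical all_reals all_analysis.
Import Order.TTheory GRing.Theory Num.Theory numFieldNormedType.Exports.

Set Implicit Arguments.
Unset Strict Implicit.
Unset Printing Implicit Defensive.

Local Open Scope classical_set_scope.
Local Open Scope ring_scope.

Section Defs.
Variable R : realType.

Definition Rge0 : set R := `[0, +oo[.

Definition pos_part (x : R) : R := Num.max x 0.

Definition xstar (x y z : R) : R := pos_part (y + z - x).

Definition Phi (phi : R -> R) (r rho : R) : R := (phi r + phi rho) ^+ 2.

(* Y_* = | sqrt((z - c)_+) + e^{i theta} sqrt((x - c)_+) |,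
   c = (x - y + s^2)^2/(4 s^2), for s > 0 ; Y_* = 0 for s = 0.
   The complex modulus |u + e^{i th} v| is written out as
   sqrt((u + v cos th)^2 + (v sin th)^2). *)
Definition Ystar (x y z s theta : R) : R :=
  if s == 0 then 0 else
  let c := (x - y + s ^+ 2) ^+ 2 / (4 * s ^+ 2) in
  let u := Num.sqrt (pos_part (z - c)) in
  let v := Num.sqrt (pos_part (x - c)) in
  Num.sqrt ((u + v * cos theta) ^+ 2 + (v * sin theta) ^+ 2).

Notation leb := (@lebesgue_measure R).

Definition W (phi : R -> R) (x y z : R) : R :=
  let xs := xstar x y z in
  if 0 < xs * x * y * z then
    (4 * pi * Num.sqrt (x * y * z))^-1 *
    Rintegral leb
      `[Num.max `|Num.sqrt x - Num.sqrt y| `|Num.sqrt xs - Num.sqrt z|,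
        Num.min (Num.sqrt x + Num.sqrt y) (Num.sqrt xs + Num.sqrt z)]
      (fun s => Rintegral leb `[0, 2 * pi]
         (fun th => Phi phi (Num.sqrt 2 * s) (Num.sqrt 2 * Ystar x y z s th)))
  else if [&& x == 0, 0 < y & 0 < z] then
    Phi phi (Num.sqrt (2 * y)) (Num.sqrt (2 * z)) / Num.sqrt (y * z)
  else if [&& y == 0, 0 < x & x < z] then
    Phi phi (Num.sqrt (2 * x)) (Num.sqrt (2 * (z - x))) / Num.sqrt (x * z)
  else if [&& z == 0, 0 < x & x < y] then
    Phi phi (Num.sqrt (2 * (y - x))) (Num.sqrt (2 * x)) / Num.sqrt (x * y)
  else 0.

Definition Kop (phi f : R -> R) (x y z : R) : R :=
  W phi x y z * (f x + f (xstar x y z) - f y - f z).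

Definition Jop (phi f : R -> R) (y z : R) : R :=
  2^-1 * Rintegral leb `[0, y + z] (fun x => Kop phi f x y z * Num.sqrt x).

(* x^q with the convention 0^q = +oo for q < 0 (and 0^0 = 1, 0^q = 0, q > 0) *)
Definition powq (q x : R) : \bar R :=
  if (x == 0) && (q < 0) then +oo%E else (x `^ q)%:E.

Definition Mq (q : R) (F : {measure set R -> \bar R}) : \bar R :=
  (\int[F]_(x in Rge0) powq q x)%E.

Definition Nmass (F : {measure set R -> \bar R}) : \bar R := Mq 0 F.
Definition Energy (F : {measure set R -> \bar R}) : \bar R := Mq 1 F.

Definition B1plus (F : {measure set R -> \bar R}) : Prop :=
  F `]-oo, 0[%classic = 0%E /\ (\int[F]_(x in Rge0) (1 + x)%:E < +oo)%E.

Definition deriv_within (A : set R) (g : R -> R) (x l : R) : Prop :=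
  (fun y => (g y - g x) / (y - x)) @ within (A `\ x) (nbhs x) --> l.

Definition C11b (f : R -> R) : Prop :=
  exists df : R -> R,
    (forall x, 0 <= x -> deriv_within Rge0 f x (df x)) /\
    (exists M, forall x, 0 <= x -> `|f x| <= M) /\
    (exists M, forall x, 0 <= x -> `|df x| <= M) /\
    (exists L, forall x y, 0 <= x -> 0 <= y -> `|df x - df y| <= L * `|x - y|).

Definition is_solution (phi : R -> R)
    (F : R -> {finite_measure set R -> \bar R}) : Prop :=
  (forall t, 0 <= t -> B1plus (F t)) /\
  (forall t, 0 <= t -> Nmass (F t) = Nmass (F 0) /\ Energy (F t) = Energy (F 0)) /\
  (forall f, C11b f ->
     let g := fun t => Rintegral (F t) Rge0 f in
     let h := fun t =>
       Rintegral ((F t) \x (F t))%E (Rge0 `*` Rge0)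
                 (fun yz => Jop phi f yz.1 yz.2) +
       Rintegral (((F t) \x (F t)) \x (F t))%E ((Rge0 `*` Rge0) `*` Rge0)
                 (fun xyz => Kop phi f xyz.1.1 xyz.1.2 xyz.2) in
     (forall t, 0 <= t -> deriv_within Rge0 g t (h t)) /\
     {within Rge0, continuous h}).

Definition kernel_assumption (phi : R -> R) (b0 eta : R) (k dk : R -> R) : Prop :=
  {within Rge0, continuous phi} /\
  (exists M, forall r, 0 <= r -> `|phi r| <= M) /\
  0 < b0 /\ 1 <= eta /\
  (forall r, 0 <= r -> 0 <= phi r <= b0 * (r `^ eta / (1 + r `^ eta))) /\
  (forall x, x \in `[1, Num.sqrt 2] -> deriv_within `[1, Num.sqrt 2] k x (dk x)) /\
  {within `[1, Num.sqrt 2], continuous dk} /\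
  k 1 = 1 /\
  (forall r a, 0 < r -> 1 < a <= Num.sqrt 2 -> phi (a * r) <= k a * phi r).

Definition q1 (k dk : R -> R) : R :=
  sup [set Num.max (2 * k x * dk x) 0 | x in `[1, Num.sqrt 2]].

End Defs.

(* Main.v *)
(* The test functions f(x) = (x + e)^(-p) are nonnegative, nonincreasing and
   convex, and sqrt x * f x is nondecreasing because p <= 1/2.  The quadratic
   term is bounded by W sqrt x <= 8 b0^2 / sqrt (y + z) and the interpolation
   M_(1/2-p) <= N^(1/2+p) E^(1/2-p).  The cubic term is symmetrized over the six
   permutations of energies x <= y <= z: values with y in first position are
   nonpositive by convexity, those with z in first position are controlled by
   the monotonicity of sqrt x * f x, and those with x in first position are
   harmless unless z >= 16 y.  In that case (x,y,z) is paired with (y,x,z) and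
   (x,z,y) with (y,z,x); the kernels of a pair differ by O(b0^2 (1 + q1)),
   because phi (t r) <= (1 + q1 (t - 1)) phi r for 1 <= t <= sqrt 2.  This gives
   d/dt int f dF_t <= a + b int f dF_t; Gronwall's lemma and monotone
   convergence as e -> 0 conclude. *)

Require Import Defs.
From HB Require Import structures.
From mathcomp Require Import all_boot all_order all_algebra.
From mathcomp Require Import all_classical all_reals all_analysis.
From mathcomp Require Import measurable_realfun ring lra.
Import Order.TTheory GRing.Theory Num.Theory numFieldNormedType.Exports.
Set Implicit Arguments.
Unset Strict Implicit.
Unset Printing Implicit Defensive.
Local Open Scope classical_set_scope.
Local Open Scope ring_scope.

(** * Integrals of functions that need not be measurable *)

Section IntegralComparison.
Context d (T : measurableType d) (R : realType).
Variables (mu : {measure set T -> \bar R}) (D : set T).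

Lemma ge0_le_integral_nonmeasurable (f g : T -> \bar R) :
  (forall x, D x -> 0 <= f x)%E -> (forall x, D x -> f x <= g x)%E ->
  (\int[mu]_(x in D) f x <= \int[mu]_(x in D) g x)%E.
Proof.
move=> f0 fg.
have g0 x : D x -> (0 <= g x)%E by move=> Dx; exact: le_trans (f0 _ Dx) (fg _ Dx).
rewrite !ge0_integralE//; apply: ereal_sup_le => _ [h hf <-].
by exists h => // x; apply: (le_trans (hf x)); apply: lee_restrict.
Qed.

(* The integral of an arbitrary function is a difference of two suprema, and
   [fine] sends both infinities to [0]. *)
Lemma le_Rintegral_nonmeasurable (f g : T -> R) :
  (forall x, D x -> 0 <= g x) -> (forall x, D x -> f x <= g x) ->
  (\int[mu]_(x in D) (g x)%:E < +oo)%E ->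
  \int[mu]_(x in D) f x <= \int[mu]_(x in D) g x.
Proof.
move=> g0 fg goo; rewrite /Rintegral.
have G0 : (0 <= \int[mu]_(x in D) (g x)%:E)%E.
  by apply: integral_ge0 => x Dx; rewrite lee_fin g0.
have : (\int[mu]_(x in D) (f x)%:E <= \int[mu]_(x in D) (g x)%:E)%E.
  rewrite integralE.
  apply: (@le_trans _ _ (\int[mu]_(x in D) (fun x => (f x)%:E)^\+ x)%E).
    by rewrite geeDl// oppe_le0 integral_ge0.
  apply: ge0_le_integral_nonmeasurable => x Dx //.
  by rewrite funeposE ge_max !lee_fin fg//= g0.
case: (integral mu D (fun x => (f x)%:E)) => [r| |] rg /=.
- by rewrite -lee_fin fineK// ge0_fin_numE.
- exact: fine_ge0.
- exact: fine_ge0.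
Qed.

Hypothesis mD : measurable D.
Hypothesis muD : (mu D < +oo)%E.

Lemma Rintegral_le_cst (f : T -> R) (M : R) :
  0 <= M -> (forall x, D x -> f x <= M) ->
  \int[mu]_(x in D) f x <= M * fine (mu D).
Proof.
move=> M0 fM; rewrite -Rintegral_cst//; apply: le_Rintegral_nonmeasurable => //.
by rewrite integral_cst// lte_mul_pinfty ?lee_fin.
Qed.

Lemma Rintegral_leD_cst (f g : T -> R) (C : R) :
  mu.-integrable D (EFin \o f) -> mu.-integrable D (EFin \o g) ->
  (forall x, D x -> f x <= g x + C) ->
  \int[mu]_(x in D) f x <= \int[mu]_(x in D) g x + C * fine (mu D).
Proof.
move=> fi gi fg.
have Ci : mu.-integrable D (EFin \o cst C).
  apply/integrableP; split; first exact/measurable_EFinP/measurable_cst.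
  by rewrite (integral_cst _ mD `|C|%:E) lte_mul_pinfty.
rewrite -Rintegral_cst// -RintegralD//; apply: le_Rintegral => //.
exact: (integrableD mD gi Ci).
Qed.

End IntegralComparison.

Section LebesgueInterval.
Variables (R : realType) (l h : R).
Local Notation leb := (@lebesgue_measure R).
Implicit Types (f g : R -> R) (M C : R).

Lemma lebesgue_measure_itvcc_lty : (leb `[l, h]%classic < +oo)%E.
Proof. by rewrite lebesgue_measure_itv/=; case: ifP => _; rewrite ?ltry// -EFinD ltry. Qed.

Lemma fine_lebesgue_measure_itvcc : fine (leb `[l, h]%classic) = Num.max (h - l) 0.
Proof.
rewrite lebesgue_measure_itv/= lte_fin; case: ltP => lh /=.
- by apply/esym/max_idPl; rewrite subr_ge0 ltW.
- by apply/esym/max_idPr; rewrite subr_le0.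
Qed.

Lemma Rintegral_itv_le_cst f M : 0 <= M -> (forall x, l <= x <= h -> f x <= M) ->
  \int[leb]_(x in `[l, h]) f x <= M * Num.max (h - l) 0.
Proof.
move=> M0 fM; rewrite -fine_lebesgue_measure_itvcc.
apply: (@Rintegral_le_cst _ _ _ leb) => //; exact: lebesgue_measure_itvcc_lty.
Qed.

Lemma Rintegral_itv_leD_cst f g C : l <= h ->
  leb.-integrable `[l, h] (EFin \o f) -> leb.-integrable `[l, h] (EFin \o g) ->
  (forall x, l <= x <= h -> f x <= g x + C) ->
  \int[leb]_(x in `[l, h]) f x <= \int[leb]_(x in `[l, h]) g x + C * (h - l).
Proof.
move=> lh fi gi fg.
have <- : fine (leb `[l, h]%classic) = h - l.
  by rewrite fine_lebesgue_measure_itvcc max_l// subr_ge0.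
apply: (@Rintegral_leD_cst _ _ _ leb) => //; exact: lebesgue_measure_itvcc_lty.
Qed.

End LebesgueInterval.

Lemma Rintegral_not_integrable d (T : measurableType d) (R : realType)
    (mu : {measure set T -> \bar R}) (D : set T) (f : T -> R) :
  measurable D -> measurable_fun D f -> ~ mu.-integrable D (EFin \o f) ->
  \int[mu]_(x in D) f x = 0.
Proof.
move=> mD mf nif; rewrite /Rintegral.
have : (\int[mu]_(x in D) (f x)%:E)%E \isn't a fin_num.
  apply/negP; rewrite -integral_fin_num_abs// => foo; apply: nif.
  by apply/integrableP; split=> //; exact/measurable_EFinP.
by case: integral.
Qed.

(** * Averaging over measure-preserving maps *)

Section MeasurePreserving.
Context d (T : measurableType d) (R : realType).
Variable mu : {measure set T -> \bar R}.

Definition measure_preserving (s : T -> T) : Prop :=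
  measurable_fun setT s /\
  forall f : T -> \bar R, measurable_fun setT f -> (forall x, 0 <= f x)%E ->
    (\int[mu]_x f (s x) = \int[mu]_x f x)%E.

Lemma measure_preserving_id : measure_preserving id.
Proof. by split. Qed.

Lemma measure_preserving_comp s s' :
  measure_preserving s -> measure_preserving s' -> measure_preserving (s \o s').
Proof.
move=> [ms s_int] [ms' s'_int]; split; first exact: measurableT_comp.
move=> f mf f0; rewrite -(s_int f)// -(s'_int (f \o s))//=.
exact: measurableT_comp.
Qed.

Section Composition.
Variables (s : T -> T) (f : T -> R).
Hypothesis sP : measure_preserving s.

Lemma integrable_measure_preserving :
  mu.-integrable setT (EFin \o f) -> mu.-integrable setT (EFin \o (f \o s)).
Proof.
have [ms s_int] := sP; move=> /integrableP[mf foo]; apply/integrableP; split.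
  exact: (measurableT_comp mf ms).
by rewrite (s_int (fun x => `|(f x)%:E|)%E)//; exact: measurableT_comp.
Qed.

Lemma Rintegral_measure_preserving : measurable_fun setT f ->
  \int[mu]_x f (s x) = \int[mu]_x f x.
Proof.
have [ms s_int] := sP; move=> /measurable_EFinP mf.
rewrite /Rintegral integralE [in RHS]integralE; congr (fine (_ - _)).
- rewrite -(s_int (EFin \o f)^\+%E)//; last exact: measurable_funepos.
  by apply: eq_integral => x _; rewrite !funeposE.
- rewrite -(s_int (EFin \o f)^\-%E)//; last exact: measurable_funeneg.
  by apply: eq_integral => x _; rewrite !funenegE.
Qed.

End Composition.

Section Average.
Variables (I : finType) (s : I -> T -> T).
Hypothesis sP : forall i, measure_preserving (s i).

Lemma integrable_sum_measure_preserving (f : T -> R) :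
  mu.-integrable setT (EFin \o f) ->
  mu.-integrable setT (EFin \o (fun x => \sum_i f (s i x))).
Proof.
move=> fi; rewrite (_ : _ \o _ = fun x => \sum_i (EFin \o (f \o s i)) x)%E.
  by apply: integrable_sum => // i _; exact: integrable_measure_preserving.
by apply/funext => x; rewrite /= sumEFin.
Qed.

Lemma Rintegral_sum_measure_preserving (f : T -> R) :
  mu.-integrable setT (EFin \o f) ->
  \int[mu]_x \sum_i f (s i x) = #|I|%:R * \int[mu]_x f x.
Proof.
move=> fi.
have mf : measurable_fun setT f by case/integrableP: fi => /measurable_EFinP.
have fsi i : mu.-integrable setT (EFin \o (f \o s i)).
  exact: integrable_measure_preserving.
rewrite [LHS]/Rintegral; under eq_integral do rewrite -sumEFin.
rewrite (integral_sum measurableT (f := fun i => EFin \o (f \o s i)))//.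
rewrite (eq_bigr (fun=> (\int[mu]_x f x)%:E)) => [|i _].
  by rewrite sumEFin /= sumr_const mulr_natl.
rewrite -(Rintegral_measure_preserving (sP i) mf) /Rintegral fineK//.
exact: integrable_fin_num (fsi i).
Qed.

Lemma Rintegral_le_average (K G : T -> R) (i0 : I) :
  measurable_fun setT K -> mu.-integrable setT (EFin \o G) -> 0 <= \int[mu]_x G x ->
  (forall x, \sum_i K (s i x) <= \sum_i G (s i x)) ->
  \int[mu]_x K x <= \int[mu]_x G x.
Proof.
move=> mK Gi G0 KG.
have [Ki|nKi] := pselect (mu.-integrable setT (EFin \o K)); last first.
  by rewrite (Rintegral_not_integrable _ mK).
have I0 : 0 < #|I|%:R :> R by rewrite ltr0n; apply/card_gt0P; exists i0.
rewrite -(ler_pM2l I0) -!Rintegral_sum_measure_preserving//.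
by apply: le_Rintegral => //; exact: integrable_sum_measure_preserving.
Qed.

Lemma Rintegral_set_le_average (D : set T) (K G : T -> R) (i0 : I) :
  measurable D -> (forall i x, D (s i x) <-> D x) ->
  measurable_fun D K -> mu.-integrable D (EFin \o G) -> 0 <= \int[mu]_(x in D) G x ->
  (forall x, D x -> \sum_i K (s i x) <= \sum_i G (s i x)) ->
  \int[mu]_(x in D) K x <= \int[mu]_(x in D) G x.
Proof.
move=> mD sD mK Gi; rewrite !(Rintegral_mkcond _ D) => G0 KG.
apply: (Rintegral_le_average i0) => //.
- by apply/(measurable_restrictT _ mD).
- by move: Gi; rewrite (integrable_mkcond _ mD) restrict_EFin.
have sDE i x : (s i x \in D) = (x \in D) by apply/idP/idP; rewrite !inE sD.
move=> x; under eq_bigr do rewrite patchE sDE; under [leRHS]eq_bigr do rewrite patchE sDE.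
by case: (boolP (x \in D)) => [/set_mem|_]; [exact: KG|exact: lexx].
Qed.

End Average.

End MeasurePreserving.

Section ProductSet.
Context d1 d2 (T1 : measurableType d1) (T2 : measurableType d2) (R : realType).
Variable m1 : {sigma_finite_measure set T1 -> \bar R}.
Variable m2 : {sigma_finite_measure set T2 -> \bar R}.
Variables (A : set T1) (B : set T2).
Hypotheses (mA : measurable A) (mB : measurable B).

Lemma ge0_integral_setX (f : T1 * T2 -> \bar R) :
  measurable_fun (A `*` B) f -> (forall w, (A `*` B) w -> 0 <= f w)%E ->
  (\int[m1 \x m2]_(w in A `*` B) f w =
    \int[m1]_(x in A) \int[m2]_(y in B) f (x, y))%E.
Proof.
move=> mf f0; have mAB : measurable (A `*` B) by exact: measurableX.
rewrite integral_mkcond fubini_tonelli1; last 2 first.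
- by apply/(measurable_restrictT _ mAB).
- by move=> w; rewrite patchE; case: ifP => // /set_mem; exact: f0.
rewrite [RHS]integral_mkcond; apply: eq_integral => x _.
rewrite patchE /fubini_F; case: ifPn => [/set_mem|/negP] xA.
  rewrite [RHS]integral_mkcond; apply: eq_integral => y _; rewrite !patchE.
  by congr (if _ then _ else _); apply/idP/idP => [/set_mem[_] ?|/set_mem ?]; exact/mem_set.
apply: integral0_eq => y _; rewrite patchE; case: ifP => // /set_mem[/= Ax _].
by case: xA; exact/mem_set.
Qed.

Lemma ge0_integral_setX_fst (f : T1 -> \bar R) :
  measurable_fun A f -> (forall x, A x -> 0 <= f x)%E ->
  (\int[m1 \x m2]_(w in A `*` B) f w.1 = (\int[m1]_(x in A) f x) * m2 B)%E.
Proof.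
move=> mf f0; rewrite ge0_integral_setX; last 2 first.
- apply: (measurable_comp mA _ mf) => [_ [w [] Aw _ <-]//|].
  exact: measurable_funTS.
- by move=> w [/f0].
under eq_integral => x xA do rewrite (integral_cst _ mB (f x)).
by rewrite ge0_integralZr.
Qed.

Lemma ge0_integral_setX_snd (f : T2 -> \bar R) :
  measurable_fun B f -> (forall y, B y -> 0 <= f y)%E ->
  (\int[m1 \x m2]_(w in A `*` B) f w.2 = m1 A * \int[m2]_(y in B) f y)%E.
Proof.
move=> mf f0; rewrite ge0_integral_setX; last 2 first.
- apply: (measurable_comp mB _ mf) => [_ [w [] _ Bw <-]//|].
  exact: measurable_funTS.
- by move=> w [_ /f0].
by rewrite (integral_cst _ mA (\int[m2]_(y in B) f y)%E) muleC.
Qed.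

End ProductSet.

Lemma ge0_integral_setX_add d (T : measurableType d) (R : realType)
    (mu : {sigma_finite_measure set T -> \bar R}) (D : set T) (f : T -> \bar R) :
  measurable D -> measurable_fun D f -> (forall x, D x -> 0 <= f x)%E ->
  (\int[mu \x mu]_(w in D `*` D) (f w.1 + f w.2) = (mu D * \int[mu]_(x in D) f x) *+ 2)%E.
Proof.
move=> mD mf f0; have mDD : measurable (D `*` D) by exact: measurableX.
rewrite ge0_integralD//.
- rewrite (ge0_integral_setX_fst _ _ mD mD mf f0) (ge0_integral_setX_snd _ _ mD mD mf f0).
  by rewrite muleC mule2n.
- by move=> w [/f0].
- apply: (measurable_comp mD _ mf) => [_ [w [] Dw _ <-]//|].
  exact: measurable_funTS.
- by move=> w [_ /f0].
- apply: (measurable_comp mD _ mf) => [_ [w [] _ Dw <-]//|].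
  exact: measurable_funTS.
Qed.

(** * Permutation invariance of the triple product measure *)

Section TripleProduct.
Context d (T : measurableType d) (R : realType).
Variable mu : {finite_measure set T -> \bar R}.
Local Notation mu3 := ((mu \x mu) \x mu)%E.
Implicit Types f : T * T * T -> \bar R.

(* The library declares [mu \x mu] sigma-finite only for subprobabilities, so
   Fubini on the triple product goes through this named copy of [mu \x mu]. *)
Definition prod2 : set (T * T)%type -> \bar R := (mu \x mu)%E.

HB.instance Definition _ := Measure.on prod2.

Lemma prod2_fin_num_fun : fin_num_fun prod2.
Proof.
apply: lty_fin_num_fun; rewrite /prod2 -setXTT [ltLHS]product_measure1E//.
by rewrite lte_mul_pinfty// ?fin_num_measure// -ge0_fin_numE// fin_num_measure.
Qed.

HB.instance Definition _ := Measure_isFinite.Build _ _ _ prod2 prod2_fin_num_fun.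

Lemma ge0_integral3E f : measurable_fun setT f -> (forall w, 0 <= f w)%E ->
  (\int[mu3]_w f w = \int[mu]_x \int[mu]_y \int[mu]_z f (x, y, z))%E.
Proof.
move=> mf f0; rewrite (@fubini_tonelli1 _ _ _ _ _ prod2 mu f mf f0).
apply: (@fubini_tonelli1 _ _ _ _ _ mu mu (fubini_F mu f)).
  exact: measurable_fun_fubini_tonelli_F.
by move=> w; exact: integral_ge0.
Qed.

Section FirstCoordinate.
Variables (D : set T) (g : T -> R).
Hypotheses (mD : measurable D) (mg : measurable_fun D g).
Hypothesis g0 : forall x, D x -> 0 <= g x.
Hypothesis gi : (\int[mu]_(x in D) (g x)%:E < +oo)%E.

Let mgE : measurable_fun D (EFin \o g).
Proof. exact/measurable_EFinP. Qed.

Let gE0 x : D x -> (0 <= (EFin \o g) x)%E.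
Proof. by move=> /g0; rewrite lee_fin. Qed.

Lemma integral_setX3_fst :
  (\int[mu3]_(w in (D `*` D) `*` D) (g w.1.1)%:E =
    (fine (mu D) ^+ 2 * \int[mu]_(x in D) g x)%:E)%E.
Proof.
have mDD : measurable (D `*` D) by exact: measurableX.
have mg1 : measurable_fun (D `*` D) (fun w : T * T => (g w.1)%:E).
  apply: (measurable_comp mD _ mgE) => [_ [w [] Dw _ <-]//|].
  exact: measurable_funTS.
rewrite (@ge0_integral_setX_fst _ _ _ _ _ prod2 mu _ _ mDD mD _ mg1); last first.
  by move=> w [/gE0].
have -> : (\int[prod2]_(w in D `*` D) (g w.1)%:E = \int[mu]_(x in D) (g x)%:E * mu D)%E.
  exact: ge0_integral_setX_fst.
have gfin : (\int[mu]_(x in D) (g x)%:E)%E \is a fin_num.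
  by rewrite ge0_fin_numE// integral_ge0.
by rewrite expr2 !EFinM !fineK ?fin_num_measure// -muleA muleC.
Qed.

Lemma integrable_setX3_fst :
  mu3.-integrable ((D `*` D) `*` D) (fun w => (g w.1.1)%:E).
Proof.
apply/integrableP; split.
  apply: (measurable_comp mD _ mgE) => [_ [w [[Dw _] _] <-]//|].
  by apply: measurable_funTS; exact: measurableT_comp.
rewrite (eq_integral (fun w => (g w.1.1)%:E)); first by rewrite integral_setX3_fst ltry.
by move=> w /set_mem[[Dw _] _]; rewrite gee0_abs// gE0.
Qed.

End FirstCoordinate.

Definition swap12 (w : T * T * T) : T * T * T := ((w.1.2, w.1.1), w.2).
Definition swap23 (w : T * T * T) : T * T * T := ((w.1.1, w.2), w.1.2).

Lemma measurable_swap12 : measurable_fun setT swap12.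
Proof.
apply/measurable_fun_pair; last exact: measurable_snd.
apply/measurable_fun_pair.
- exact: (measurableT_comp measurable_snd measurable_fst).
- exact: (measurableT_comp measurable_fst measurable_fst).
Qed.

Lemma measurable_swap23 : measurable_fun setT swap23.
Proof.
apply/measurable_fun_pair.
- apply/measurable_fun_pair; last exact: measurable_snd.
  exact: (measurableT_comp measurable_fst measurable_fst).
- exact: (measurableT_comp measurable_snd measurable_fst).
Qed.

Lemma measure_preserving_swap12 : measure_preserving mu3 swap12.
Proof.
split=> [|f mf f0]; first exact: measurable_swap12.
have mfs := measurableT_comp mf measurable_swap12.
apply: (etrans (ge0_integral3E mfs (fun w => f0 _))).
apply: (etrans _ (esym (ge0_integral3E mf f0))) => /=.
apply: (@fubini_tonelli _ _ _ _ _ mu mu (fun p => \int[mu]_z f (p.2, p.1, z))%E).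
- by apply: (@measurable_fun_fubini_tonelli_F _ _ _ _ _ mu _ mfs) => w; exact: f0.
- by move=> w; exact: integral_ge0.
Qed.

Lemma measure_preserving_swap23 : measure_preserving mu3 swap23.
Proof.
split=> [|f mf f0]; first exact: measurable_swap23.
have mfs := measurableT_comp mf measurable_swap23.
apply: (etrans (ge0_integral3E mfs (fun w => f0 _))).
apply: (etrans _ (esym (ge0_integral3E mf f0))) => /=.
apply: eq_integral => x _.
apply: (@fubini_tonelli _ _ _ _ _ mu mu (fun p => f (x, p.2, p.1))%E) => //.
apply: (measurableT_comp mf); apply/measurable_fun_pair; last exact: measurable_fst.
by apply/measurable_fun_pair; [exact: measurable_cst|exact: measurable_snd].
Qed.

Definition permute3 (i : 'I_6) (w : T * T * T) : T * T * T :=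
  let: (x, y, z) := w in
  nth w [:: (x, y, z); (x, z, y); (y, x, z); (y, z, x); (z, x, y); (z, y, x)] i.

Lemma measure_preserving_permute3 i : measure_preserving mu3 (permute3 i).
Proof.
have s12 := measure_preserving_swap12; have s23 := measure_preserving_swap23.
pose S := [:: id; swap23; swap12; swap23 \o swap12; swap12 \o swap23;
              swap23 \o (swap12 \o swap23)].
rewrite (_ : permute3 i = nth id S i); last first.
  apply/funext => -[[x y] z].
  by case: i => -[|[|[|[|[|[|//]]]]]].
case: i => -[|[|[|[|[|[|//]]]]]] _ /=; first exact: measure_preserving_id.
- exact: s23.
- exact: s12.
- exact: measure_preserving_comp s23 s12.
- exact: measure_preserving_comp s12 s23.
- exact: measure_preserving_comp s23 (measure_preserving_comp s12 s23).
Qed.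

Lemma Rintegral_le_symmetrized3 (D : set T) (K : T -> T -> T -> R) (g : T -> R) (C : R) :
  measurable D -> measurable_fun setT (fun w : T * T * T => K w.1.1 w.1.2 w.2) ->
  measurable_fun D g -> (forall x, D x -> 0 <= g x) ->
  (\int[mu]_(x in D) (g x)%:E < +oo)%E -> 0 <= C ->
  (forall x y z, D x -> D y -> D z ->
    K x y z + K x z y + (K y x z + K y z x) + (K z x y + K z y x) <=
      C * (g x + g y + g z)) ->
  \int[mu3]_(w in (D `*` D) `*` D) K w.1.1 w.1.2 w.2 <=
    C / 2 * (fine (mu D) ^+ 2 * \int[mu]_(x in D) g x).
Proof.
move=> mD mK mg g0 gi C0 symK.
have D3 : measurable ((D `*` D) `*` D) by do 2 apply: measurableX => //.
have gD3 := integrable_setX3_fst mD mg g0 gi.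
have -> : C / 2 * (fine (mu D) ^+ 2 * \int[mu]_(x in D) g x) =
    \int[mu3]_(w in (D `*` D) `*` D) (C / 2 * g w.1.1).
  by rewrite RintegralZl// [in RHS]/Rintegral integral_setX3_fst.
apply: (Rintegral_set_le_average measure_preserving_permute3 ord0) => //.
- case=> -[|[|[|[|[|[|//]]]]]] ? [[x y] z] /=; split=> -[[? ?] ?]; by repeat split.
- exact: measurable_funTS.
- exact: (integrableZl D3 (C / 2) gD3).
- apply: Rintegral_ge0 => w [[/g0 gw _] _].
  by rewrite !mulr_ge0 ?invr_ge0.
- move=> [[x y] z] [[/= Dx Dy] Dz]; rewrite !big_ord_recl !big_ord0 /=.
  by have := symK x y z Dx Dy Dz; lra.
Qed.

End TripleProduct.

(** * One-sided derivatives and Gronwall's lemma *)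

Lemma Rge0P (R : realType) (x : R) : Rge0 x <-> 0 <= x.
Proof. by rewrite /Rge0/= in_itv/= andbT. Qed.

Section DerivWithin.
Variable R : realType.
Implicit Types (A : set R) (g : R -> R) (x l : R).

Lemma deriv_within_caratheodory A g x l : deriv_within A g x l ->
  exists q : R -> R, [/\ forall y, g y - g x = q y * (y - x),
    q y @[y --> within A (nbhs x)] --> l & q x = l].
Proof.
move=> gl; exists (fun y => if y == x then l else (g y - g x) / (y - x)); split.
- move=> y; case: eqVneq => [->|yx]; first by rewrite !subrr mulr0.
  by rewrite divfK// subr_eq0.
- apply/cvgrPdist_lt => e e0; move/cvgrPdist_lt/(_ e e0) : gl.
  rewrite !near_withinE; apply: filterS => y gly Ay.
  case: eqVneq => [_|yx]; first by rewrite subrr normr0.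
  by apply: gly; split=> //; exact/eqP.
- by rewrite eqxx.
Qed.

Lemma deriv_within_is_derive A g x l : nbhs x A -> deriv_within A g x l ->
  is_derive x 1 g l.
Proof.
move=> xA /deriv_within_caratheodory[q [gq ql qx]].
apply/is_derive1_caratheodory; exists q; split=> //; rewrite -qx in ql.
by apply: cvg_trans ql => P qP; apply: filterS2 xA qP => y Ay; exact.
Qed.

Lemma is_derive_deriv_within A g x l : is_derive x 1 g l -> deriv_within A g x l.
Proof.
move=> /is_derive1_caratheodory[q [gq cq <-]].
apply: cvg_trans (cvg_within_filter (A `\ x) cq).
apply: near_eq_cvg; rewrite near_withinE; near=> y => -[_ /eqP yx].
by rewrite gq mulfK// subr_eq0.
Unshelve. all: by end_near.
Qed.

Lemma deriv_within_continuous A g x l : deriv_within A g x l ->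
  g y @[y --> within A (nbhs x)] --> g x.
Proof.
move=> /deriv_within_caratheodory[q [gq ql _]].
rewrite (_ : g = fun y => g x + q y * (y - x)); last first.
  by apply/funext => y; rewrite -gq addrC subrK.
rewrite subrr mulr0; apply: cvgD; first exact: cvg_cst.
rewrite -[X in _ --> X](mulr0 l); apply: cvgM => //; rewrite -(subrr x).
by apply: cvgB; [exact: cvg_within|exact: cvg_cst].
Qed.

End DerivWithin.

Section RealDerivative.
Variable R : realType.
Implicit Types (f : R -> R) (x : R).

Lemma is_derive_continuous f x df : is_derive x 1 f df -> {for x, continuous f}.
Proof. by move=> fx; apply: differentiable_continuous; apply/derivable1_diffP. Qed.

Lemma is_derive_within_continuous f (df : R -> R) (i : interval R) :
  (forall x, x \in i -> is_derive x 1 f (df x)) -> {within [set` i], continuous f}.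
Proof. by move=> fd; apply: derivable_within_continuous => x /fd. Qed.

Lemma is_derive_lipschitz f (df : R -> R) (L : R) :
  (forall x, 0 <= x -> is_derive x 1 f (df x)) ->
  (forall x, 0 <= x -> `|df x| <= L) ->
  forall x y, 0 <= x -> 0 <= y -> `|f x - f y| <= L * `|x - y|.
Proof.
move=> fd dfL x y; wlog xy : x y / x <= y => [le_case x0 y0|x0 _].
  by have [/le_case|/ltW/le_case] := leP x y; [|rewrite distrC (distrC x)]; exact.
have fxy z : z \in `[x, y] -> is_derive z 1 f (df z).
  by rewrite in_itv/= => /andP[xz _]; exact: fd (le_trans x0 xz).
have [z] := MVT_segment xy (fun z zI => fxy z (subset_itv_oo_cc zI))
  (is_derive_within_continuous fxy).
rewrite in_itv/= => /andP[xz _] fE.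
by rewrite distrC (distrC x) fE normrM ler_wpM2r// dfL// (le_trans x0).
Qed.

Lemma integral_is_derive (f F : R -> R) (a b : R) : a < b ->
  (forall x, x \in `[a, b] -> is_derive x 1 F (f x)) ->
  {within `[a, b], continuous f} ->
  (\int[lebesgue_measure]_(x in `[a, b]) (f x)%:E = (F b - F a)%:E)%E.
Proof.
move=> ab dF cf; have cF x : x \in `[a, b] -> {for x, continuous F}.
  by move=> /dF; exact: is_derive_continuous.
rewrite EFinB (continuous_FTC2 (F := F) ab cf)//; last first.
  by move=> x /subset_itv_oo_cc/dF xF; rewrite derive1E derive_val.
split.
- by move=> x /subset_itv_oo_cc/dF xF; exact: ex_derive.
- by apply: cvg_at_right_filter; apply: cF; rewrite in_itv/= lexx ltW.
- by apply: cvg_at_left_filter; apply: cF; rewrite in_itv/= lexx ltW.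
Qed.

Lemma is_derive_expR_linear (c x : R) :
  is_derive x 1 (fun x => expR (c * x)) (c * expR (c * x)).
Proof.
have cx : is_derive x 1 (fun x : R => c * x) c.
  by apply: is_derive_eq; rewrite /GRing.scale/= mulr1.
by have := is_derive1_comp (is_derive_expR (c * x)) cx; rewrite mulrC.
Qed.

End RealDerivative.

Section Gronwall.
Variables (R : realType) (G h : R -> R) (a b : R).
Hypotheses (a_ge0 : 0 <= a) (b_ge0 : 0 <= b).
Hypothesis dG : forall t, 0 <= t -> deriv_within (@Rge0 R) G t (h t).
Hypothesis h_le : forall t, 0 <= t -> h t <= a + b * G t.

Let u (t : R) : R := expR (- b * t) * G t - a * t.

Let is_derive_u (t : R) : 0 < t -> is_derive t 1 u (expR (- b * t) * (h t - b * G t) - a).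
Proof.
move=> t0.
have tR : nbhs t (@Rge0 R).
  by apply: filterS (lt_nbhsr t0) => s /ltW /Rge0P.
have Gt := deriv_within_is_derive tR (dG (ltW t0)).
have et := is_derive_expR_linear (- b) t.
by apply: is_derive_eq; rewrite /GRing.scale/=; ring.
Qed.

Let within_continuous_u : {within @Rge0 R, continuous u}.
Proof.
have cG : {within @Rge0 R, continuous G}.
  apply/subspace_continuousP => t /Rge0P t0.
  exact: deriv_within_continuous (dG t0).
have ce : {within @Rge0 R, continuous (fun t => expR (- b * t))}.
  apply: continuous_subspaceT => t; exact: is_derive_continuous (is_derive_expR_linear _ t).
have ca : {within @Rge0 R, continuous (fun t => a * t)}.
  by apply: continuous_subspaceT => t; exact: mulrl_continuous.
by move=> t; apply: cvgB; [apply: cvgM; [exact: ce|exact: cG]|exact: ca].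
Qed.

Lemma gronwall_within (t : R) : 0 <= t -> G t <= (a * t + G 0) * expR (b * t).
Proof.
move=> t0; have du_le0 s : s \in `]0, +oo[ -> u^`()%classic s <= 0.
  rewrite in_itv/= andbT => s0.
  have us := is_derive_u s0; rewrite derive1E derive_val subr_le0.
  have e1 : expR (- b * s) <= 1.
    by rewrite -expR0 ler_expR mulNr oppr_le0 mulr_ge0// ltW.
  apply: (@le_trans _ _ (expR (- b * s) * a)); last exact: ler_piMl.
  by rewrite ler_pM2l ?expR_gt0// lerBlDr h_le// ltW.
have ut : u t <= u 0.
  apply: (ler0_derive1_nincry _ du_le0 within_continuous_u) => // s.
  by rewrite in_itv/= andbT => /is_derive_u us; exact: ex_derive.
have -> : G t = expR (- b * t) * G t * expR (b * t).
  by rewrite mulrAC -expRD mulNr addNr expR0 mul1r.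
rewrite ler_pM2r ?expR_gt0//; move: ut; rewrite /u !mulr0 expR0; lra.
Qed.

End Gronwall.

(** * Real powers *)

Section RealPower.
Variable R : realType.
Implicit Types (a b r x y p e : R).

Lemma powR_subadditive a b r : 0 <= a -> 0 <= b -> r <= 1 ->
  (a + b) `^ r <= a `^ r + b `^ r.
Proof.
rewrite le_eqVlt => /predU1P[<-|a0]; first by rewrite add0r lerDr powR_ge0.
rewrite le_eqVlt => /predU1P[<-|b0] r1; first by rewrite addr0 lerDl powR_ge0.
have ab0 : 0 < a + b by exact: addr_gt0.
have share c : 0 < c <= a + b -> c / (a + b) * (a + b) `^ r <= c `^ r.
  move=> /andP[c0 cab]; have cab0 : 0 < c / (a + b) by rewrite divr_gt0.
  have cab1 : 0 < c / (a + b) <= 1 by rewrite cab0 ler_pdivrMr// mul1r.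
  rewrite -[in leRHS](divfK (lt0r_neq0 ab0) c) [leRHS]powRM ?(ltW cab0) ?(ltW ab0)//.
  by rewrite ler_wpM2r ?powR_ge0// ger1_powR.
have -> : (a + b) `^ r = a / (a + b) * (a + b) `^ r + b / (a + b) * (a + b) `^ r.
  by rewrite -!mulrDl divff ?mul1r// gt_eqF.
by rewrite lerD// share ?a0 ?b0 ?lerDl ?lerDr ?ltW.
Qed.

Lemma le_powRN x y p : 0 <= p -> 0 < x -> x <= y -> y `^ (- p) <= x `^ (- p).
Proof.
move=> p0 x0 xy; have y0 : 0 < y by exact: lt_le_trans xy.
rewrite !powRN lef_pV2 ?posrE ?powR_gt0//.
by apply: ge0_ler_powR; rewrite ?nnegrE// ltW.
Qed.

(* t^(-p) = exp (- p ln t) >= 1 - p ln t >= 1 - p (t - 1) at t = x / y *)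
Lemma powRN_ge_tangent x y p : 0 < x -> 0 < y -> 0 <= p ->
  y `^ (- p) * (1 - p * (x / y - 1)) <= x `^ (- p).
Proof.
move=> x0 y0 p0; have xy0 : 0 < x / y by rewrite divr_gt0.
have {2}-> : x = y * (x / y) by rewrite mulrC divfK// gt_eqF.
rewrite [leRHS]powRM ?(ltW y0) ?(ltW xy0)// ler_wpM2l ?powR_ge0//.
rewrite /powR gt_eqF//; apply: le_trans (expR_ge1Dx _).
have lnxy : ln (x / y) <= x / y - 1.
  by have := @le_ln1Dx _ (x / y - 1); rewrite addrCA subrr addr0; apply; lra.
have := ler_wpM2l p0 lnxy; lra.
Qed.

Lemma is_derive_powR_shift r e x : 0 < x + e ->
  is_derive x 1 (fun x => (x + e) `^ r) (r * (x + e) `^ (r - 1)).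
Proof.
move=> xe; have shift_e : is_derive x 1 (fun x : R => x + e) 1.
  by apply: is_derive_eq; rewrite addr0.
rewrite -[X in is_derive _ _ _ X]mulr1.
exact: (@is_derive1_comp _ (@powR R ^~ r) (fun x => x + e) _ _ _ (is_derive1_powR r xe)).
Qed.

End RealPower.

Lemma integral_powR_le d (T : measurableType d) (R : realType)
    (mu : {measure set T -> \bar R}) (D : set T) (f : T -> R) (r : R) :
  measurable D -> measurable_fun D f -> (forall x, D x -> 0 <= f x) -> 0 <= r <= 1 ->
  (\int[mu]_(x in D) (f x `^ r)%:E <=
    (\int[mu]_(x in D) (f x)%:E) `^ r * mu D `^ (1 - r))%E.
Proof.
move=> mD mf f0 /andP[]; rewrite le_eqVlt => /predU1P[<- _|r0].
  under eq_integral do rewrite powRr0.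
  by rewrite (integral_cst _ mD 1%E) subr0 poweRe0 poweRe1.
rewrite le_eqVlt => /predU1P[->|r1].
  rewrite subrr poweRe0 mule1 poweRe1; last by apply: integral_ge0 => x /f0.
  by under eq_integral => x /set_mem/f0 fx do rewrite powRr1//.
pose F := (fun x => f x `^ r) \_ D; pose I := (\1_D : T -> R).
have mF : measurable_fun setT F.
  apply/(measurable_restrictT _ mD).
  exact: (measurableT_comp (measurable_powR r) mf).
have mI : measurable_fun setT I by exact: measurable_indic.
have := hoelder mu mF mI (p := r^-1) (q := (1 - r)^-1).
rewrite !invr_gt0 subr_gt0 !invrK => /(_ r0 r1); rewrite addrC subrK => /(_ erefl).
congr (_ <= _ * _)%E.
- rewrite Lnorm1 [RHS]integral_mkcond; apply: eq_integral => x _ /=.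
  rewrite /F /I !patchE indicE; case: ifP => _; last by rewrite mul0r normr0.
  by rewrite mulr1 ger0_norm// powR_ge0.
- rewrite unlock invrK; congr (_ `^ _)%E; rewrite [RHS]integral_mkcond.
  apply: eq_integral => x _ /=; rewrite /F !patchE; case: ifPn => [/set_mem/f0 fx|_].
    rewrite ger0_norm ?powR_ge0// -powRrM mulfV ?gt_eqF// powRr1//.
  by rewrite normr0 powR0// invr_neq0// gt_eqF.
- rewrite unlock invrK; congr (_ `^ _)%E; rewrite -[in RHS](setIT D) -integral_indic//.
  apply: eq_integral => x _ /=; rewrite /I indicE ger0_norm//.
  case: (x \in D); rewrite ?powR1// powR0// invr_neq0//.
  by rewrite subr_eq0 gt_eqF.
Qed.

(** * Regularized negative powers *)

Lemma C11b_of_second_derivative (R : realType) (f df ddf : R -> R) (M0 M1 M2 : R) :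
  (forall x : R, 0 <= x -> is_derive x 1 f (df x)) ->
  (forall x : R, 0 <= x -> is_derive x 1 df (ddf x)) ->
  (forall x, 0 <= x -> `|f x| <= M0) -> (forall x, 0 <= x -> `|df x| <= M1) ->
  (forall x, 0 <= x -> `|ddf x| <= M2) -> C11b f.
Proof.
move=> fd dfd fM dfM ddfM; exists df; split; last split; last split.
- by move=> x /fd; exact: is_derive_deriv_within.
- by exists M0.
- by exists M1.
- by exists M2; exact: is_derive_lipschitz dfd ddfM.
Qed.

Section RegularizedPower.
Variables (R : realType) (p e : R).
Hypotheses (p_gt0 : 0 < p) (e_gt0 : 0 < e).
Implicit Types x y t : R.

Definition reg_power x : R := (x + e) `^ (- p).

Let shift_gt0 x : 0 <= x -> 0 < x + e.
Proof. by move=> x0; rewrite ltr_wpDl. Qed.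

Lemma reg_power_ge0 x : 0 <= reg_power x.
Proof. exact: powR_ge0. Qed.

Lemma reg_power_le x y : 0 <= x -> x <= y -> reg_power y <= reg_power x.
Proof. by move=> x0 xy; apply: le_powRN; rewrite ?lerD2r ?shift_gt0 ?(ltW p_gt0). Qed.

Lemma reg_power_convex x y t : 0 <= x -> 0 <= y -> 0 <= t <= 1 ->
  reg_power ((1 - t) * x + t * y) <= (1 - t) * reg_power x + t * reg_power y.
Proof.
move=> x0 y0 /andP[t0 t1]; set m := (1 - t) * x + t * y.
have t1' : 0 <= 1 - t by rewrite subr_ge0.
have m0 : 0 < m + e by rewrite shift_gt0 ?addr_ge0 ?mulr_ge0.
have tangent_x := powRN_ge_tangent (shift_gt0 x0) m0 (ltW p_gt0).
have tangent_y := powRN_ge_tangent (shift_gt0 y0) m0 (ltW p_gt0).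
apply: le_trans (lerD (ler_wpM2l t1' tangent_x) (ler_wpM2l t0 tangent_y)).
rewrite -/(reg_power m) le_eqVlt; apply/orP; left; apply/eqP.
transitivity (reg_power m * (1 - p * ((m + e) / (m + e) - 1))).
  by rewrite divff ?gt_eqF// subrr mulr0 subr0 mulr1.
by rewrite /m; ring.
Qed.

Lemma sqrt_mul_reg_power_le x y : p <= 2^-1 -> 0 <= x -> x <= y ->
  Num.sqrt x * reg_power x <= Num.sqrt y * reg_power y.
Proof.
move=> p_le x0 xy; have y0 : 0 <= y by exact: le_trans xy.
have xe := shift_gt0 x0; have ye := shift_gt0 y0.
rewrite /reg_power !powRN ler_pdivrMr ?powR_gt0// mulrAC ler_pdivlMr ?powR_gt0//.
set r := (x + e) / (y + e).
have r0 : 0 < r by rewrite divr_gt0.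
have r1 : 0 < r <= 1 by rewrite r0 ler_pdivrMr// mul1r lerD2r.
have -> : (x + e) `^ p = r `^ p * (y + e) `^ p.
  by rewrite -powRM ?(ltW r0) ?(ltW ye)// divfK// gt_eqF.
rewrite mulrA ler_wpM2r ?powR_ge0//.
apply: (@le_trans _ _ (Num.sqrt y * r `^ 2^-1)); last first.
  by rewrite ler_wpM2l ?sqrtr_ge0// ger_powR.
rewrite powR12_sqrt ?(ltW r0)// -sqrtrM// ler_wsqrtr// mulrA ler_pdivlMr//.
have := ler_wpM2r (ltW e_gt0) xy; lra.
Qed.

Lemma measurable_reg_power : measurable_fun [set: R] reg_power.
Proof.
apply: (measurableT_comp (f := @powR R ^~ (- p))); first exact: measurable_powR.
by apply: measurable_funD => //; exact: measurable_cst.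
Qed.

Lemma reg_power_C11b : C11b reg_power.
Proof.
have bound (c r x : R) : r <= 0 -> 0 <= x -> `|c * (x + e) `^ r| <= `|c| * e `^ r.
  move=> r0 x0; rewrite normrM [X in _ * X]ger0_norm ?powR_ge0// ler_wpM2l//.
  by rewrite -(opprK r) le_powRN ?lerDr// oppr_ge0.
apply: (@C11b_of_second_derivative _ _ (fun x => - p * (x + e) `^ (- p - 1))
  (fun x => - p * (- p - 1) * (x + e) `^ (- p - 1 - 1))
  (`|1| * e `^ (- p)) (`|- p| * e `^ (- p - 1)) (`|- p * (- p - 1)| * e `^ (- p - 1 - 1))).
- by move=> x /shift_gt0; exact: is_derive_powR_shift.
- move=> x /shift_gt0 xe; have dpow := is_derive_powR_shift (- p - 1) xe.
  by apply: is_derive_eq; rewrite /GRing.scale/= mulrA.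
- by move=> x x0; rewrite -[reg_power x]mul1r bound// oppr_le0 ltW.
- by move=> x x0; rewrite bound// -opprD oppr_le0 addr_ge0// ltW.
- by move=> x x0; rewrite bound// -!opprD oppr_le0 !addr_ge0// ltW.
Qed.

Let reflected_primitive (S x : R) : R :=
  (1 - p)^-1 * ((x + e) `^ (1 - p) - (S - x + e) `^ (1 - p)).

Let is_derive_reflected_primitive (S x : R) : p < 1 -> 0 <= x <= S ->
  is_derive x 1 (reflected_primitive S) (reg_power x + reg_power (S - x)).
Proof.
move=> p1 /andP[/shift_gt0 xe xS].
have Sxe : 0 < S - x + e by rewrite shift_gt0// subr_ge0.
have d_shift := is_derive_powR_shift (1 - p) xe.
have d_reflect : is_derive x 1 (fun x => (S - x + e) `^ (1 - p))
    ((1 - p) * (S - x + e) `^ (1 - p - 1) * -1).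
  apply: (@is_derive1_comp _ (fun x : R => (x + e) `^ (1 - p)) (fun x : R => S - x)).
    exact: is_derive_powR_shift.
  by apply: is_derive_eq; rewrite add0r mul1r.
apply: is_derive_eq; rewrite /GRing.scale/= /reg_power (_ : 1 - p - 1 = - p); last by ring.
by field; rewrite subr_eq0 gt_eqF.
Qed.

Lemma integral_reg_powerD_reflect_le (S : R) : p < 1 -> 0 <= S ->
  (\int[lebesgue_measure]_(x in `[0%R, S]) (reg_power x + reg_power (S - x))%:E <=
    (2 / (1 - p) * S `^ (1 - p))%:E)%E.
Proof.
move=> p1; have q0 : 0 < 1 - p by rewrite subr_gt0.
rewrite le_eqVlt => /predU1P[<-|S0].
  by rewrite set_itv1 integral_set1 lee_fin mulr_ge0 ?powR_ge0// divr_ge0// ltW.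
have dF x : x \in `[0, S] ->
    is_derive x 1 (reflected_primitive S) (reg_power x + reg_power (S - x)).
  by rewrite in_itv/=; exact: is_derive_reflected_primitive.
rewrite (integral_is_derive S0 dF); last first.
  apply: continuous_in_subspaceT => x; rewrite inE/= in_itv/= => /andP[x0 xS].
  have cr y : 0 <= y -> {for y, continuous reg_power}.
    by move=> /shift_gt0 ye; exact: is_derive_continuous (is_derive_powR_shift (- p) ye).
  apply: cvgD; first exact: cr.
  apply: (@continuous_comp _ _ _ (fun x : R => S - x) reg_power).
    by apply: cvgB; [exact: cvg_cst|exact: cvg_id].
  by apply: cr; rewrite subr_ge0.
rewrite lee_fin /reflected_primitive subrr subr0 !add0r -mulrBr (mulrC 2) -mulrA.
rewrite ler_pM2l ?invr_gt0//.
have : (S + e) `^ (1 - p) <= S `^ (1 - p) + e `^ (1 - p).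
  by apply: powR_subadditive; rewrite ?gerBl ?ltW.
by lra.
Qed.

Lemma integral_mul_reg_powerD_reflect_le (c S : R) : 0 <= c -> p < 1 -> 0 <= S ->
  (\int[lebesgue_measure]_(x in `[0%R, S]) (c * (reg_power x + reg_power (S - x)))%:E <=
    (c * (2 / (1 - p) * S `^ (1 - p)))%:E)%E.
Proof.
move=> c0 p1 S0; under eq_integral do rewrite EFinM.
rewrite ge0_integralZl_EFin//.
- by rewrite (EFinM c) lee_wpmul2l ?lee_fin// integral_reg_powerD_reflect_le.
- by move=> x _; rewrite lee_fin addr_ge0 ?reg_power_ge0.
apply/measurable_EFinP; apply: measurable_funTS.
apply: measurable_funD; first exact: measurable_reg_power.
apply: (measurableT_comp measurable_reg_power).
by apply: measurable_funB => //; exact: measurable_cst.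
Qed.

End RegularizedPower.

(** * The collision kernel *)

Section SquareRoot.
Variable R : realType.
Implicit Types x y : R.

Lemma ler_sqrW x y : 0 <= y -> x ^+ 2 <= y ^+ 2 -> x <= y.
Proof. by move=> y0 xy; rewrite leNgt; apply/negP => yx; nra. Qed.

Lemma sqrtr_le_of_sqr x y : 0 <= y -> x <= y ^+ 2 -> Num.sqrt x <= y.
Proof. by move=> y0 xy; rewrite -(ger0_norm y0) -sqrtr_sqr ler_wsqrtr. Qed.

Lemma sqrtr_sqr_ge0 x : 0 <= x -> Num.sqrt (x ^+ 2) = x.
Proof. by move=> x0; rewrite sqrtr_sqr ger0_norm. Qed.

Lemma sqr_sqrt2 : Num.sqrt 2 ^+ 2 = 2 :> R.
Proof. by rewrite sqr_sqrtr. Qed.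

Lemma pos_part_ge0 x : 0 <= pos_part x.
Proof. by rewrite /pos_part le_max lexx orbT. Qed.

Lemma ge0_pos_part x : 0 <= x -> pos_part x = x.
Proof. by move=> x0; apply/max_idPl. Qed.

Lemma le0_pos_part x : x <= 0 -> pos_part x = 0.
Proof. by move=> x0; apply/max_idPr. Qed.

Lemma pos_part_le x y : 0 <= y -> x <= y -> pos_part x <= y.
Proof. by move=> y0 xy; rewrite /pos_part ge_max xy. Qed.

End SquareRoot.

Section Modulus.
Variable R : realType.
Implicit Types u v x y z s th : R.

(* |u + v e^(i th)| *)
Definition modulus u v th : R :=
  Num.sqrt ((u + v * cos th) ^+ 2 + (v * sin th) ^+ 2).

Lemma modulus_ge0 u v th : 0 <= modulus u v th.
Proof. exact: sqrtr_ge0. Qed.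

Lemma sqr_modulus u v th :
  modulus u v th ^+ 2 = u ^+ 2 + v ^+ 2 + 2 * u * v * cos th.
Proof.
rewrite sqr_sqrtr; last by rewrite addr_ge0// sqr_ge0.
transitivity (u ^+ 2 + v ^+ 2 * (cos th ^+ 2 + sin th ^+ 2) + 2 * u * v * cos th).
  by ring.
by rewrite cos2Dsin2 mulr1.
Qed.

Lemma modulusC u v th : modulus u v th = modulus v u th.
Proof.
apply/eqP; rewrite -(@eqrXn2 _ 2) ?modulus_ge0//.
by apply/eqP; rewrite !sqr_modulus; ring.
Qed.

Lemma modulus_leD u v th : 0 <= u -> 0 <= v -> modulus u v th <= u + v.
Proof.
move=> u0 v0; apply: ler_sqrW; first by rewrite addr_ge0.
rewrite sqr_modulus; have := cos_le1 th; have : 0 <= u * v by rewrite mulr_ge0.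
by nra.
Qed.

Lemma modulus_geB u v th : 0 <= u -> 0 <= v -> u - v <= modulus u v th.
Proof.
move=> u0 v0; apply: ler_sqrW; first exact: modulus_ge0.
rewrite sqr_modulus; have := cos_geN1 th; have : 0 <= u * v by rewrite mulr_ge0.
by nra.
Qed.

Lemma modulus_subl_le u u' v th :
  u' <= u -> modulus u v th - modulus u' v th <= u - u'.
Proof.
move=> uu'; rewrite lerBlDl; apply: ler_sqrW.
  by rewrite addr_ge0 ?modulus_ge0// subr_ge0.
have re_le : u' + v * cos th <= modulus u' v th.
  apply: ler_sqrW; first exact: modulus_ge0.
  by rewrite sqr_sqrtr ?lerDl ?addr_ge0 ?sqr_ge0.
have := sqr_modulus u v th; have := sqr_modulus u' v th.
by nra.
Qed.

Lemma le_modulusl u u' v th :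
  0 <= v <= u' -> u' <= u -> modulus u' v th <= modulus u v th.
Proof.
move=> /andP[v0 vu'] u'u; apply: ler_sqrW; first exact: modulus_ge0.
rewrite !sqr_modulus; have cos_ge := cos_geN1 th; have cos_le := cos_le1 th.
have : 0 <= (u - u') * (u + u' + 2 * v * cos th) by rewrite mulr_ge0//; nra.
by nra.
Qed.

Definition proj x y s : R := (x - y + s ^+ 2) / (2 * s).

Lemma Ystar_modulus x y z s th : s != 0 -> Ystar x y z s th =
  modulus (Num.sqrt (pos_part (z - proj x y s ^+ 2)))
          (Num.sqrt (pos_part (x - proj x y s ^+ 2))) th.
Proof.
rewrite /Ystar => /negbTE->; suff -> : proj x y s ^+ 2 =
  (x - y + s ^+ 2) ^+ 2 / (4 * s ^+ 2) by [].
by rewrite /proj expr_div_n exprMn -natrX.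
Qed.

Lemma Ystar_ge0 x y z s th : 0 <= Ystar x y z s th.
Proof. by rewrite /Ystar; case: ifP => // _; exact: sqrtr_ge0. Qed.

Lemma Ystar_le x y z s th c : 0 <= c -> x <= c ^+ 2 -> z <= c ^+ 2 ->
  Ystar x y z s th <= 2 * c.
Proof.
move=> c0 xc zc; have [->|s0] := eqVneq s 0.
  by rewrite /Ystar eqxx mulr_ge0.
rewrite Ystar_modulus//; apply: (le_trans (modulus_leD _ (sqrtr_ge0 _) (sqrtr_ge0 _))).
rewrite mulr_natl mulr2n; apply: lerD; apply: sqrtr_le_of_sqr => //;
  apply: pos_part_le; rewrite ?sqr_ge0// lerBlDr; apply: ler_wpDr => //; exact: sqr_ge0.
Qed.

End Modulus.

Section EnergyVariable.
Variable R : realType.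
Implicit Types x y z : R.

Lemma xstarC x y z : xstar x y z = xstar x z y.
Proof. by rewrite /xstar (addrC y). Qed.

Lemma xstar_ge0 x y z : 0 <= xstar x y z.
Proof. exact: pos_part_ge0. Qed.

Lemma xstarE x y z : x <= y + z -> xstar x y z = y + z - x.
Proof. by move=> xyz; rewrite /xstar ge0_pos_part// subr_ge0. Qed.

Lemma xstar_eq0 x y z : y + z <= x -> xstar x y z = 0.
Proof. by move=> yzx; rewrite /xstar le0_pos_part// subr_le0. Qed.

(* Integration bounds of the variable [s] in the definition of [W]. *)
Definition smin x y z : R := Num.max `|Num.sqrt x - Num.sqrt y|
  `|Num.sqrt (xstar x y z) - Num.sqrt z|.
Definition smax x y z : R := Num.min (Num.sqrt x + Num.sqrt y)
  (Num.sqrt (xstar x y z) + Num.sqrt z).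

Lemma smin_ge0 x y z : 0 <= smin x y z.
Proof. by rewrite /smin le_max normr_ge0. Qed.

Lemma smaxB_smin_le x y z : smax x y z - smin x y z <=
  2 * Num.min (Num.min (Num.sqrt x) (Num.sqrt y))
              (Num.min (Num.sqrt (xstar x y z)) (Num.sqrt z)).
Proof.
have sumB_dist (u v : R) : u + v - `|u - v| = 2 * Num.min u v.
  by case: (leP u v) => uv; [rewrite ler0_norm|rewrite gtr0_norm]; lra.
rewrite minr_pMr// -!sumB_dist le_min /smin /smax; apply/andP; split; apply: lerB;
  by rewrite ?ge_min ?le_max lexx ?orbT.
Qed.

End EnergyVariable.

(* The bound b0 r^eta / (1 + r^eta) is only used through b0 min(1, r). *)
Record kernel_bounds (R : realType) (phi : R -> R) (b0 q : R) : Prop := {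
  kernel_continuous : continuous phi;
  kernel_b0_ge0 : 0 <= b0;
  kernel_q_ge0 : 0 <= q;
  kernel_ge0 : forall r, 0 <= phi r;
  kernel_le : forall r, phi r <= b0;
  kernel_le_linear : forall r, 0 <= r -> phi r <= b0 * r;
  kernel_dilation_le : forall r t, 0 < r -> 1 <= t <= Num.sqrt 2 ->
    phi (t * r) <= (1 + q * (t - 1)) * phi r }.

Section CrossSection.
Variables (R : realType) (phi : R -> R).
Implicit Types r rho : R.

Lemma Phi_ge0 r rho : 0 <= Phi phi r rho.
Proof. exact: sqr_ge0. Qed.

Lemma PhiC r rho : Phi phi r rho = Phi phi rho r.
Proof. by rewrite /Phi addrC. Qed.

Variables b0 q : R.
Hypothesis kb : kernel_bounds phi b0 q.
Let b0_ge0 := kernel_b0_ge0 kb.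
Let q_ge0 := kernel_q_ge0 kb.

Lemma Phi_le r rho : Phi phi r rho <= 4 * b0 ^+ 2.
Proof.
have -> : 4 * b0 ^+ 2 = (b0 + b0) ^+ 2 by ring.
rewrite ler_sqr ?nnegrE ?addr_ge0 ?(kernel_ge0 kb)//.
by apply: lerD; exact: kernel_le kb _.
Qed.

Lemma Phi_le_sqr r rho : 0 <= r -> 0 <= rho ->
  Phi phi r rho <= b0 ^+ 2 * (r + rho) ^+ 2.
Proof.
move=> r0 rho0; rewrite -exprMn ler_sqr ?nnegrE ?mulr_ge0 ?addr_ge0 ?(kernel_ge0 kb)//.
by rewrite mulrDr lerD// (kernel_le_linear kb).
Qed.

Lemma Phi_sub_le r rho rho' : 0 <= r -> 0 < rho' -> rho' <= rho ->
  rho <= Num.sqrt 2 * rho' ->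
  Phi phi r rho - Phi phi r rho' <=
    q * b0 ^+ 2 * ((rho - rho') * (2 * r + rho + rho')).
Proof.
move=> r0 rho'0 rho'_le rho_le.
have rho0 : 0 <= rho by apply: le_trans rho'_le; exact: ltW.
have phi_sub : phi rho - phi rho' <= q * b0 * (rho - rho').
  have t12 : 1 <= rho / rho' <= Num.sqrt 2.
    by rewrite ler_pdivlMr// mul1r rho'_le/= ler_pdivrMr.
  have := kernel_dilation_le kb rho'0 t12; rewrite divfK ?gt_eqF// => dil.
  have -> : rho - rho' = (rho / rho' - 1) * rho' by rewrite mulrBl mul1r divfK ?gt_eqF.
  case/andP: t12 => t1 _.
  have qt : 0 <= q * (rho / rho' - 1) by rewrite mulr_ge0// subr_ge0.
  by have := ler_wpM2l qt (kernel_le_linear kb (ltW rho'0)); lra.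
have -> : Phi phi r rho - Phi phi r rho' =
  (phi rho - phi rho') * (2 * phi r + phi rho + phi rho') by rewrite /Phi; ring.
have sum_ge0 : 0 <= 2 * phi r + phi rho + phi rho'.
  by rewrite !addr_ge0 ?mulr_ge0 ?(kernel_ge0 kb).
have sum_le : 2 * phi r + phi rho + phi rho' <= b0 * (2 * r + rho + rho').
  have := kernel_le_linear kb r0; have := kernel_le_linear kb rho0.
  by have := kernel_le_linear kb (ltW rho'0); lra.
have qb : 0 <= q * b0 * (rho - rho') by rewrite !mulr_ge0// subr_ge0.
by have := ler_wpM2r sum_ge0 phi_sub; have := ler_wpM2l qb sum_le; lra.
Qed.

Lemma Phi_sqrt2_le r rho c : 0 <= r -> 0 <= rho -> r + rho <= c ->
  Phi phi (Num.sqrt 2 * r) (Num.sqrt 2 * rho) <= 2 * b0 ^+ 2 * c ^+ 2.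
Proof.
move=> r0 rho0 rc; have w0 := sqrtr_ge0 (2 : R).
apply: (le_trans (Phi_le_sqr (mulr_ge0 w0 r0) (mulr_ge0 w0 rho0))).
rewrite -mulrDr exprMn sqr_sqrt2 mulrA (mulrC 2) ler_wpM2l ?mulr_ge0 ?sqr_ge0//.
by rewrite ler_sqr ?nnegrE ?addr_ge0// (le_trans (addr_ge0 r0 rho0)).
Qed.

(* For Y, Y' of order c the hypotheses give Y / Y' <= sqrt 2. *)
Lemma Phi_sqrt2_sub_le r Y Y' b c : 0 <= r -> 0 <= b -> 4 * b <= c -> 0 < c ->
  c / 2 <= Y' -> Y' <= Y -> (Y - Y') * c <= b ^+ 2 -> 2 * r + Y + Y' <= 5 * c ->
  Phi phi (Num.sqrt 2 * r) (Num.sqrt 2 * Y) - Phi phi (Num.sqrt 2 * r) (Num.sqrt 2 * Y') <=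
    10 * (q * b0 ^+ 2) * b ^+ 2.
Proof.
move=> r0 b0' bc c0 cY' Y'Y dY sum_le.
have w_ge : 9 / 8 <= Num.sqrt 2 :> R.
  by apply: ler_sqrW; rewrite ?sqrtr_ge0// sqr_sqrt2; lra.
have w0 : 0 < Num.sqrt 2 :> R by lra.
have Y'0 : 0 < Y' by lra.
have dY_le : Y - Y' <= c / 16.
  by rewrite -(ler_pM2r c0); apply: (le_trans dY); nra.
have Y_le : Num.sqrt 2 * Y <= Num.sqrt 2 * (Num.sqrt 2 * Y') by rewrite ler_pM2l//; nra.
have wY'Y : Num.sqrt 2 * Y' <= Num.sqrt 2 * Y by rewrite ler_pM2l.
apply: (le_trans (Phi_sub_le (mulr_ge0 (ltW w0) r0) (mulr_gt0 w0 Y'0) wY'Y Y_le)).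
have -> : (Num.sqrt 2 * Y - Num.sqrt 2 * Y') *
    (2 * (Num.sqrt 2 * r) + Num.sqrt 2 * Y + Num.sqrt 2 * Y') =
    2 * ((Y - Y') * (2 * r + Y + Y')).
  by rewrite -[X in X * ((Y - _) * _)]sqr_sqrt2; ring.
have dY_sum : (Y - Y') * (2 * r + Y + Y') <= (Y - Y') * (5 * c).
  by rewrite ler_wpM2l// subr_ge0.
have -> : 10 * (q * b0 ^+ 2) * b ^+ 2 = q * b0 ^+ 2 * (10 * b ^+ 2) by ring.
by rewrite ler_wpM2l ?mulr_ge0 ?sqr_ge0//; lra.
Qed.

End CrossSection.

Section CollisionKernel.
Variables (R : realType) (phi : R -> R).
Implicit Types x y z s th : R.

Local Notation leb := (@lebesgue_measure R).

Definition angular_integral x y z s : R :=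
  \int[leb]_(th in `[0, 2 * pi]) Phi phi (Num.sqrt 2 * s) (Num.sqrt 2 * Ystar x y z s th).

Lemma angular_integral_ge0 x y z s : 0 <= angular_integral x y z s.
Proof. by apply: Rintegral_ge0 => th _; exact: Phi_ge0. Qed.

Lemma angular_integral_le x y z s M : 0 <= M ->
  (forall th, Phi phi (Num.sqrt 2 * s) (Num.sqrt 2 * Ystar x y z s th) <= M) ->
  angular_integral x y z s <= M * (2 * pi).
Proof.
move=> M0 PhiM; have -> : 2 * pi = Num.max (2 * pi - 0) 0 :> R.
  by rewrite subr0 max_l// mulr_ge0// pi_ge0.
by apply: Rintegral_itv_le_cst.
Qed.

Lemma W_nondegenerateE x y z : 0 < x -> 0 < y -> 0 < z -> 0 < xstar x y z ->
  W phi x y z = (4 * pi * Num.sqrt (x * y * z))^-1 *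
    \int[leb]_(s in `[smin x y z, smax x y z]) angular_integral x y z s.
Proof. by move=> x0 y0 z0 xs0; rewrite /W !mulr_gt0. Qed.

Lemma W_xstar0 x y z : 0 < x -> 0 < y -> 0 < z -> xstar x y z = 0 -> W phi x y z = 0.
Proof. by move=> x0 y0 z0 xs0; rewrite /W xs0 !mul0r ltxx !gt_eqF. Qed.

Lemma W_x0 y z : 0 < y -> 0 < z -> W phi 0 y z =
  Phi phi (Num.sqrt (2 * y)) (Num.sqrt (2 * z)) / Num.sqrt (y * z).
Proof. by move=> y0 z0; rewrite /W !(mulr0, mul0r) ltxx eqxx y0 z0. Qed.

Lemma W_y0 x z : 0 < x -> 0 < z -> W phi x 0 z =
  if x < z then Phi phi (Num.sqrt (2 * x)) (Num.sqrt (2 * (z - x))) / Num.sqrt (x * z)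
  else 0.
Proof.
by move=> x0 z0; rewrite /W !(mulr0, mul0r) ltxx eqxx x0 (gt_eqF x0) (gt_eqF z0).
Qed.

Lemma W_z0 x y : 0 < x -> 0 < y -> W phi x y 0 =
  if x < y then Phi phi (Num.sqrt (2 * (y - x))) (Num.sqrt (2 * x)) / Num.sqrt (x * y)
  else 0.
Proof.
by move=> x0 y0; rewrite /W !(mulr0, mul0r) ltxx eqxx x0 (gt_eqF x0) (gt_eqF y0).
Qed.

Lemma W_ge0 x y z : 0 <= W phi x y z.
Proof.
rewrite /W; case: ifP => _.
  rewrite mulr_ge0 ?invr_ge0 ?mulr_ge0 ?sqrtr_ge0 ?pi_ge0//.
  by apply: Rintegral_ge0 => s _; exact: angular_integral_ge0.
by do 3! [case: ifP => _; first by rewrite divr_ge0 ?Phi_ge0 ?sqrtr_ge0].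
Qed.

Section UpperBound.
Variables c M : R.
Hypotheses (c_ge0 : 0 <= c) (M_ge0 : 0 <= M).
Hypothesis Phi_leM : forall r rho, 0 <= r <= 2 * c -> 0 <= rho <= 2 * c ->
  Phi phi (Num.sqrt 2 * r) (Num.sqrt 2 * rho) <= M.

Section BoundedEnergies.
Variables x y z : R.
Hypotheses (x_le : 0 <= x <= c ^+ 2) (y_le : 0 <= y <= c ^+ 2) (z_le : 0 <= z <= c ^+ 2).

Lemma W_mul_sqrt_xyz_le : W phi x y z * Num.sqrt (x * y * z) <=
  M * Num.min (Num.min (Num.sqrt x) (Num.sqrt y))
              (Num.min (Num.sqrt (xstar x y z)) (Num.sqrt z)).
Proof.
set m := Num.min _ _; have [/andP[x0 xc] /andP[y0 yc] /andP[z0 zc]] := And3 x_le y_le z_le.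
have m0 : 0 <= m by rewrite !le_min !sqrtr_ge0.
have Mm0 : 0 <= M * m by rewrite mulr_ge0.
have [xyz0|] := eqVneq (x * y * z) 0; first by rewrite xyz0 sqrtr0 mulr0.
rewrite !mulf_eq0 !negb_or => /andP[/andP[xn0 yn0] zn0].
have [xp yp zp] : [/\ 0 < x, 0 < y & 0 < z] by rewrite !lt0r xn0 yn0 zn0.
have [xs0|xsn0] := eqVneq (xstar x y z) 0; first by rewrite W_xstar0// mul0r.
have xsp : 0 < xstar x y z by rewrite lt0r xsn0 xstar_ge0.
have pi0 := pi_gt0 R.
have s0 : 0 < Num.sqrt (x * y * z) by rewrite sqrtr_gt0 !mulr_gt0.
rewrite W_nondegenerateE// mulrAC invfM divfK ?gt_eqF// ler_pdivrMl ?mulr_gt0//.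
have -> : 4 * pi * (M * m) = M * (2 * pi) * (2 * m) by ring.
have M2pi_ge0 : 0 <= M * (2 * pi) by rewrite !mulr_ge0// ltW.
apply: (@le_trans _ _ (M * (2 * pi) * Num.max (smax x y z - smin x y z) 0)); last first.
  by rewrite ler_wpM2l// ge_max smaxB_smin_le mulr_ge0.
apply: Rintegral_itv_le_cst => // s /andP[s_ge s_le]; apply: angular_integral_le => // th.
apply: Phi_leM; last by rewrite Ystar_ge0 Ystar_le.
rewrite (le_trans (smin_ge0 x y z))//= (le_trans s_le)// /smax ge_min; apply/orP; left.
by rewrite mulr_natl mulr2n lerD// sqrtr_le_of_sqr.
Qed.

Lemma W_mul_sqrt_le : [/\ W phi x y z * Num.sqrt (x * y) <= M,
  W phi x y z * Num.sqrt (x * z) <= M & W phi x y z * Num.sqrt (y * z) <= M].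
Proof.
have [/andP[x0 xc] /andP[y0 yc] /andP[z0 zc]] := And3 x_le y_le z_le.
have Phi_quot u v w : 0 <= u <= c ^+ 2 -> 0 <= v <= c ^+ 2 -> 0 < w ->
    Phi phi (Num.sqrt (2 * u)) (Num.sqrt (2 * v)) / Num.sqrt w * Num.sqrt w <= M.
  move=> /andP[u0 uc] /andP[v0 vc] w0; rewrite divfK ?gt_eqF ?sqrtr_gt0// !sqrtrM//.
  have c2 : c <= 2 * c by rewrite ler_peMl// ler1n.
  by apply: Phi_leM; rewrite sqrtr_ge0/= (le_trans _ c2)// sqrtr_le_of_sqr.
have [->|xn0] := eqVneq x 0.
  rewrite !mul0r sqrtr0 mulr0; split=> //.
  have [->|yn0] := eqVneq y 0; first by rewrite mul0r sqrtr0 mulr0.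
  have [->|zn0] := eqVneq z 0; first by rewrite mulr0 sqrtr0 mulr0.
  by rewrite W_x0 ?lt0r ?yn0 ?zn0// Phi_quot// mulr_gt0// lt0r ?yn0 ?zn0.
have xp : 0 < x by rewrite lt0r xn0.
have [->|yn0] := eqVneq y 0.
  rewrite mulr0 mul0r sqrtr0 mulr0; split=> //.
  have [->|zn0] := eqVneq z 0; first by rewrite mulr0 sqrtr0 mulr0.
  have zp : 0 < z by rewrite lt0r zn0.
  rewrite W_y0//; case: ifP => [/ltW xz|_]; last by rewrite mul0r.
  by rewrite Phi_quot ?mulr_gt0// subr_ge0 xz lerBlDr; apply: ler_wpDr.
have yp : 0 < y by rewrite lt0r yn0.
have [->|zn0] := eqVneq z 0.
  rewrite !mulr0 sqrtr0 mulr0; split=> //.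
  rewrite W_z0//; case: ifP => [/ltW xy|_]; last by rewrite mul0r.
  by rewrite Phi_quot ?mulr_gt0// subr_ge0 xy lerBlDr; apply: ler_wpDr.
have zp : 0 < z by rewrite lt0r zn0.
have := W_mul_sqrt_xyz_le; set m := Num.min _ _ => Wxyz.
have cancel u v : 0 < u -> 0 < v -> u * v = x * y * z -> m <= Num.sqrt v ->
    W phi x y z * Num.sqrt u <= M.
  move=> u0 v0 uv mv; rewrite -(@ler_pM2r _ (Num.sqrt v)) ?sqrtr_gt0//.
  by rewrite -mulrA -sqrtrM ?(ltW u0)// uv (le_trans Wxyz)// ler_wpM2l.
by split; [apply: (@cancel _ z)|apply: (@cancel _ y)|apply: (@cancel _ x)];
  rewrite ?mulr_gt0 ?ge_min ?lexx ?orbT//; ring.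
Qed.

End BoundedEnergies.
End UpperBound.

Variables b0 q : R.
Hypothesis kb : kernel_bounds phi b0 q.

Lemma W_mul_sqrtD_le x y z : 0 <= x -> 0 <= y -> 0 <= z ->
  W phi x y z * Num.sqrt x * Num.sqrt (y + z) <= 8 * b0 ^+ 2.
Proof.
move=> x0 y0 z0.
set c := Num.sqrt (x + y + z).
have cE : c ^+ 2 = x + y + z by rewrite sqr_sqrtr// !addr_ge0.
have xc : 0 <= x <= c ^+ 2 by rewrite x0 cE -addrA lerDl addr_ge0.
have yc : 0 <= y <= c ^+ 2 by rewrite y0 cE addrAC lerDr addr_ge0.
have zc : 0 <= z <= c ^+ 2 by rewrite z0 cE lerDr addr_ge0.
have M0 : 0 <= 4 * b0 ^+ 2 by rewrite mulr_ge0 ?sqr_ge0.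
have [] := W_mul_sqrt_le (sqrtr_ge0 _) M0 (fun r rho _ _ => Phi_le kb _ _) xc yc zc.
rewrite !(sqrtrM _ x0) !mulrA => Wy Wz _.
apply: (@le_trans _ _ (W phi x y z * Num.sqrt x * (Num.sqrt y + Num.sqrt z))); last first.
  by rewrite mulrDr; lra.
rewrite ler_wpM2l ?mulr_ge0 ?W_ge0 ?sqrtr_ge0//.
have sum_ge0 : 0 <= Num.sqrt y + Num.sqrt z by rewrite addr_ge0 ?sqrtr_ge0.
apply: sqrtr_le_of_sqr => //; rewrite sqrrD !sqr_sqrtr// -addrA lerD2l lerDr.
by rewrite mulrn_wge0// mulr_ge0 ?sqrtr_ge0.
Qed.

Section SquaredEnergies.
Variables c x y z : R.
Hypotheses (x_le : 0 <= x <= c) (y_le : 0 <= y <= c) (z_le : 0 <= z <= c).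

Let c_ge0 : 0 <= c.
Proof. by case/andP: x_le; exact: le_trans. Qed.

Let M_ge0 : 0 <= 32 * b0 ^+ 2 * c ^+ 2.
Proof. by rewrite -mulrA mulr_ge0// mulr_ge0 ?sqr_ge0. Qed.

Let Phi_leM r rho : 0 <= r <= 2 * c -> 0 <= rho <= 2 * c ->
  Phi phi (Num.sqrt 2 * r) (Num.sqrt 2 * rho) <= 32 * b0 ^+ 2 * c ^+ 2.
Proof.
move=> /andP[r0 rc] /andP[rho0 rhoc]; apply: (le_trans (Phi_sqrt2_le kb r0 rho0 (lerD rc rhoc))).
by rewrite le_eqVlt; apply/orP; left; apply/eqP; ring.
Qed.

Let sqr_le_sqr u : 0 <= u <= c -> 0 <= u ^+ 2 <= c ^+ 2.
Proof. by move=> /andP[u0 uc]; rewrite sqr_ge0 ler_sqr ?nnegrE. Qed.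

Let sqrt_sqrM u v : 0 <= u <= c -> 0 <= v <= c -> Num.sqrt (u ^+ 2 * v ^+ 2) = u * v.
Proof. by move=> /andP[u0 _] /andP[v0 _]; rewrite -exprMn sqrtr_sqr_ge0// mulr_ge0. Qed.

Lemma W_sqr_mul_le : [/\ W phi (x ^+ 2) (y ^+ 2) (z ^+ 2) * (x * y) <= 32 * b0 ^+ 2 * c ^+ 2,
  W phi (x ^+ 2) (y ^+ 2) (z ^+ 2) * (x * z) <= 32 * b0 ^+ 2 * c ^+ 2 &
  W phi (x ^+ 2) (y ^+ 2) (z ^+ 2) * (y * z) <= 32 * b0 ^+ 2 * c ^+ 2].
Proof.
have := W_mul_sqrt_le c_ge0 M_ge0 Phi_leM (sqr_le_sqr x_le) (sqr_le_sqr y_le) (sqr_le_sqr z_le).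
by rewrite !sqrt_sqrM.
Qed.

Lemma W_sqr_mul_xyz_le : W phi (x ^+ 2) (y ^+ 2) (z ^+ 2) * (x * y * z) <=
  32 * b0 ^+ 2 * c ^+ 2 * Num.sqrt (xstar (x ^+ 2) (y ^+ 2) (z ^+ 2)).
Proof.
have := W_mul_sqrt_xyz_le c_ge0 M_ge0 Phi_leM
  (sqr_le_sqr x_le) (sqr_le_sqr y_le) (sqr_le_sqr z_le).
rewrite (sqrtrM _ (mulr_ge0 (sqr_ge0 x) (sqr_ge0 y))) sqrt_sqrM// sqrtr_sqr_ge0; last first.
  by case/andP: z_le.
move=> /le_trans; apply; rewrite ler_wpM2l//.
by rewrite !ge_min lexx !orbT.
Qed.

End SquaredEnergies.

End CollisionKernel.

Section KernelContinuity.
Variable R : realType.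
Implicit Types x y z s th : R.

Local Notation leb := (@lebesgue_measure R).

Lemma continuous_sqrt_comp (f : R -> R) (t : R) :
  {for t, continuous f} -> {for t, continuous (fun t => Num.sqrt (f t))}.
Proof.
by move=> cf; apply: (@continuous_comp _ _ _ f Num.sqrt) => //; exact: sqrt_continuous.
Qed.

Lemma continuous_sqr_comp (f : R -> R) (t : R) :
  {for t, continuous f} -> {for t, continuous (fun t => f t ^+ 2)}.
Proof.
move=> cf; apply: (@continuous_comp _ _ _ f (fun x => x ^+ 2)) => //.
exact: exprn_continuous.
Qed.

Lemma continuous_modulus (u v th : R -> R) (t : R) :
  {for t, continuous u} -> {for t, continuous v} -> {for t, continuous th} ->
  {for t, continuous (fun t => modulus (u t) (v t) (th t))}.
Proof.
move=> cu cv cth; apply: continuous_sqrt_comp.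
have ccos : {for t, continuous (fun t => cos (th t))}.
  by apply: (@continuous_comp _ _ _ th cos) => //; exact: continuous_cos.
have csin : {for t, continuous (fun t => sin (th t))}.
  by apply: (@continuous_comp _ _ _ th sin) => //; exact: continuous_sin.
apply: cvgD.
  apply: (@continuous_sqr_comp (fun t => u t + v t * cos (th t))).
  by apply: cvgD => //; exact: cvgM.
by apply: (@continuous_sqr_comp (fun t => v t * sin (th t))); exact: cvgM.
Qed.

Lemma continuous_proj x y s : s != 0 -> {for s, continuous (proj x y)}.
Proof.
move=> s0; apply: cvgM.
  by apply: cvgD; [exact: cvg_cst|exact: exprn_continuous].
apply: cvgV; first by rewrite mulf_neq0.
by apply: cvgM; [exact: cvg_cst|exact: cvg_id].
Qed.

Lemma continuous_sqrt_pos_part_proj w x y s : s != 0 ->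
  {for s, continuous (fun s => Num.sqrt (pos_part (w - proj x y s ^+ 2)))}.
Proof.
move=> s0; apply: continuous_sqrt_comp.
apply: (@continuous_max _ _ (fun s => w - proj x y s ^+ 2) (fun=> 0)); last exact: cvg_cst.
apply: cvgB; first exact: cvg_cst.
by apply: (@continuous_sqr_comp (proj x y)); exact: continuous_proj.
Qed.

Variables (phi : R -> R) (b0 q : R).
Hypothesis kb : kernel_bounds phi b0 q.

Lemma continuous_Phi (f g : R -> R) (t : R) :
  {for t, continuous f} -> {for t, continuous g} ->
  {for t, continuous (fun t => Phi phi (Num.sqrt 2 * f t) (Num.sqrt 2 * g t))}.
Proof.
move=> cf cg; apply: (@continuous_sqr_comp (fun t => phi _ + phi _)).
have cphi (h : R -> R) : {for t, continuous h} ->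
    {for t, continuous (fun t => phi (Num.sqrt 2 * h t))}.
  move=> ch; apply: (@continuous_comp _ _ _ (fun t => Num.sqrt 2 * h t) phi).
    by apply: cvgM => //; exact: cvg_cst.
  exact: (kernel_continuous kb).
by apply: cvgD; exact: cphi.
Qed.

Lemma integrable_Phi_Ystar x y z s : s != 0 -> leb.-integrable `[0, 2 * pi]
  (EFin \o (fun th => Phi phi (Num.sqrt 2 * s) (Num.sqrt 2 * Ystar x y z s th))).
Proof.
move=> s0; apply: continuous_compact_integrable; first exact: segment_compact.
apply: continuous_subspaceT => th; rewrite (_ : (fun th => Phi _ _ _) = fun th =>
  Phi phi (Num.sqrt 2 * s) (Num.sqrt 2 * modulus
    (Num.sqrt (pos_part (z - proj x y s ^+ 2)))
    (Num.sqrt (pos_part (x - proj x y s ^+ 2))) th)).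
  apply: continuous_Phi; first exact: cvg_cst.
  by apply: continuous_modulus; [exact: cvg_cst|exact: cvg_cst|exact: cvg_id].
by apply/funext => t; rewrite Ystar_modulus.
Qed.

Lemma continuous_angular_integral x y z s : 0 < s ->
  {for s, continuous (angular_integral phi x y z)}.
Proof.
move=> s0.
apply: (@continuity_under_integral _ _ _ leb
  (fun s th => Phi phi (Num.sqrt 2 * s) (Num.sqrt 2 * Ystar x y z s th))
  `[0, 2 * pi]%classic _ 0 (s + 1) _ _ (fun=> 4 * b0 ^+ 2)).
- exact: measurable_itv.
- by move=> t /=; rewrite in_itv/= => /andP[t0 _]; apply: integrable_Phi_Ystar; rewrite gt_eqF.
- apply/aeW => th _ t; rewrite inE/= in_itv/= => /andP[t0 _].
  have cm : {for t, continuous (fun s => Phi phi (Num.sqrt 2 * s) (Num.sqrt 2 *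
      modulus (Num.sqrt (pos_part (z - proj x y s ^+ 2)))
              (Num.sqrt (pos_part (x - proj x y s ^+ 2))) th))}.
    apply: (@continuous_Phi id); first exact: cvg_id.
    apply: continuous_modulus; last exact: cvg_cst.
    - by apply: continuous_sqrt_pos_part_proj; rewrite gt_eqF.
    - by apply: continuous_sqrt_pos_part_proj; rewrite gt_eqF.
  rewrite /continuous_at Ystar_modulus ?gt_eqF//; apply: cvg_trans cm.
  apply: near_eq_cvg; near=> t'; rewrite Ystar_modulus// gt_eqF//.
  by near: t'; exact: lt_nbhsr.
- apply: continuous_compact_integrable; first exact: segment_compact.
  by apply: continuous_subspaceT => ?; exact: cvg_cst.
- by move=> t _; apply/aeW => th _; rewrite ger0_norm ?Phi_ge0//; exact: Phi_le kb _ _.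
- by rewrite inE/= in_itv/= s0/= ltrDl.
Unshelve. all: by end_near.
Qed.

Lemma within_continuous_angular_integral x y z l h : 0 < l ->
  {within `[l, h], continuous (angular_integral phi x y z)}.
Proof.
move=> l0; apply: continuous_in_subspaceT => s; rewrite inE/= in_itv/= => /andP[ls _].
by apply: continuous_angular_integral; exact: lt_le_trans ls.
Qed.

Lemma integrable_angular_integral x y z l h : 0 < l ->
  leb.-integrable `[l, h] (EFin \o angular_integral phi x y z).
Proof.
move=> l0; apply: continuous_compact_integrable; first exact: segment_compact.
exact: within_continuous_angular_integral.
Qed.

End KernelContinuity.

(** * The kernel at permuted energies [a^2 <= b^2 << c^2] *)

Section SquareRootComparison.
Variable R : realType.
Implicit Types a b c A B : R.

Lemma sqrt_sub_bounds A B b c : 0 <= b -> 4 * b <= c ->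
  c ^+ 2 - b ^+ 2 <= B -> B <= A -> A <= c ^+ 2 ->
  [/\ 3 / 4 * c <= Num.sqrt B, Num.sqrt B <= Num.sqrt A, Num.sqrt A <= c &
      (Num.sqrt A - Num.sqrt B) * c <= b ^+ 2].
Proof.
move=> b0 bc cB BA Ac; have c0 : 0 <= c by lra.
have B0 : 0 <= B by nra.
have A0 : 0 <= A by lra.
have sB : 3 / 4 * c <= Num.sqrt B.
  by apply: ler_sqrW; rewrite ?sqrtr_ge0// sqr_sqrtr//; nra.
have sBA : Num.sqrt B <= Num.sqrt A by rewrite ler_wsqrtr.
split=> //; first exact: sqrtr_le_of_sqr.
have := sqr_sqrtr A0; have := sqr_sqrtr B0; nra.
Qed.

Lemma sqrt_sqrDB_bounds a b c : 0 <= a <= b -> b <= c ->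
  c <= Num.sqrt (b ^+ 2 + c ^+ 2 - a ^+ 2) <= c + (b - a).
Proof.
move=> /andP[a0 ab] bc; apply/andP; split.
- by apply: ler_sqrW; rewrite ?sqrtr_ge0// sqr_sqrtr; nra.
- by apply: sqrtr_le_of_sqr; [lra|nra].
Qed.

Lemma sqrt_sqrBD_bounds a b c : 0 <= a <= b -> b <= c ->
  c - (b - a) <= Num.sqrt (a ^+ 2 + c ^+ 2 - b ^+ 2) <= c.
Proof.
move=> /andP[a0 ab] bc; apply/andP; split.
- by apply: ler_sqrW; rewrite ?sqrtr_ge0// sqr_sqrtr; nra.
- by apply: sqrtr_le_of_sqr; [lra|nra].
Qed.

End SquareRootComparison.

Section ProjectionInverse.
Variable R : realType.
Implicit Types A h x y : R.

(* [unproj (y - x)] inverts [proj x y].  In terms of the variable [h = proj x y s]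
   the modulus Y_* takes the same values at (a, c, b) and at (b, c, a), so that
   only [s] and the density [dunproj] differ. *)
Definition unproj A h : R := h + Num.sqrt (h ^+ 2 + A).
Definition dunproj A h : R := 1 + h / Num.sqrt (h ^+ 2 + A).

Lemma sqrD_gt0 A h : 0 < A -> 0 < h ^+ 2 + A.
Proof. by move=> A0; rewrite ltr_wpDl ?sqr_ge0. Qed.

Lemma norm_lt_sqrt_sqrD A h : 0 < A -> `|h| < Num.sqrt (h ^+ 2 + A).
Proof. by move=> A0; rewrite -sqrtr_sqr ltr_sqrt ?ltrDl// sqrD_gt0. Qed.

Lemma unproj_gt0 A h : 0 < A -> 0 < unproj A h.
Proof. by move=> /(norm_lt_sqrt_sqrD h); rewrite ltr_norml /unproj => /andP[]; lra. Qed.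

Lemma proj_unproj x y h : 0 < y - x -> proj x y (unproj (y - x) h) = h.
Proof.
move=> xy; have u0 := unproj_gt0 h xy; move: u0; rewrite /proj /unproj.
have := sqr_sqrtr (ltW (sqrD_gt0 h xy)).
move: (Num.sqrt _) => w wE u0.
have -> : x - y = h ^+ 2 - w ^+ 2 by rewrite wE; ring.
by field; rewrite gt_eqF.
Qed.

Lemma is_derive_unproj A h : 0 < A -> is_derive h 1 (unproj A) (dunproj A h).
Proof.
move=> A0; have sqrD0 := sqrD_gt0 h A0.
have dsqr : is_derive h 1 (fun h : R => h ^+ 2 + A) (h *+ 2).
  by apply: is_derive_eq; rewrite addr0 mulr2n; congr (_ + _); exact: mulr1.
have dsqrt := @is_derive1_comp _ Num.sqrt (fun h : R => h ^+ 2 + A) h _ _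
  (is_derive1_sqrt sqrD0) dsqr.
apply: is_derive_eq; congr (_ + _).
by rewrite -mulr_natr; field; rewrite gt_eqF// sqrtr_gt0.
Qed.

Lemma dunproj_gt0 A h : 0 < A -> 0 < dunproj A h.
Proof.
move=> A0; have s0 : 0 < Num.sqrt (h ^+ 2 + A) by rewrite sqrtr_gt0 sqrD_gt0.
have -> : dunproj A h = unproj A h / Num.sqrt (h ^+ 2 + A).
  by rewrite /dunproj /unproj; field; rewrite gt_eqF.
by rewrite divr_gt0// unproj_gt0.
Qed.

Lemma unproj_lt A : 0 < A -> {homo unproj A : x y / x < y}.
Proof.
move=> A0 x y xy.
have cu : {within `[x, y], continuous (unproj A)}.
  by apply: is_derive_within_continuous => h _; exact: is_derive_unproj.
have [h _] := MVT xy (fun h _ => is_derive_unproj h A0) cu.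
by move=> uE; rewrite -subr_gt0 uE mulr_gt0 ?dunproj_gt0// subr_gt0.
Qed.

Lemma continuous_unproj A h : 0 < A -> {for h, continuous (unproj A)}.
Proof. by move=> A0; exact: is_derive_continuous (is_derive_unproj h A0). Qed.

Lemma continuous_dunproj A h : 0 < A -> {for h, continuous (dunproj A)}.
Proof.
move=> A0; apply: cvgD; first exact: cvg_cst.
apply: cvgM; first exact: cvg_id.
apply: cvgV; first by rewrite gt_eqF// sqrtr_gt0 sqrD_gt0.
apply: (@continuous_sqrt_comp _ (fun h => h ^+ 2 + A)).
by apply: cvgD; [exact: exprn_continuous|exact: cvg_cst].
Qed.

End ProjectionInverse.

Section ProjectionSubstitution.
Variables (R : realType) (phi : R -> R) (b0 q : R).
Hypothesis kb : kernel_bounds phi b0 q.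
Local Notation leb := (@lebesgue_measure R).

Variables (x y z A a : R).
Hypotheses (A_gt0 : 0 < A) (a_gt0 : 0 < a).

Lemma Rintegral_angular_unproj :
  \int[leb]_(s in `[unproj A (- a), unproj A a]) angular_integral phi x y z s =
  \int[leb]_(h in `[- a, a]) (angular_integral phi x y z (unproj A h) * dunproj A h).
Proof.
have uE : (unproj A)^`()%classic = dunproj A.
  by apply/funext => h; have du := is_derive_unproj h A_gt0; rewrite derive1E derive_val.
rewrite /Rintegral (@integration_by_substitution_increasing _ (unproj A)).
- by rewrite uE.
- by rewrite ge0_cp// ltW.
- by move=> u v _ _; exact: unproj_lt.
- by rewrite uE => h _; exact: continuous_dunproj.
- rewrite uE; apply/cvg_ex; eexists; apply: cvg_at_right_filter.
  exact: continuous_dunproj.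
- rewrite uE; apply/cvg_ex; eexists; apply: cvg_at_left_filter.
  exact: continuous_dunproj.
- split.
  + by move=> h _; have du := is_derive_unproj h A_gt0; exact: ex_derive.
  + by apply: cvg_at_right_filter; exact: continuous_unproj.
  + by apply: cvg_at_left_filter; exact: continuous_unproj.
- by apply: (within_continuous_angular_integral kb); exact: unproj_gt0.
Qed.

Lemma integrable_angular_unproj : leb.-integrable `[- a, a]
  (EFin \o (fun h => angular_integral phi x y z (unproj A h) * dunproj A h)).
Proof.
apply: continuous_compact_integrable; first exact: segment_compact.
apply: continuous_in_subspaceT => h _; apply: cvgM; last exact: continuous_dunproj.
apply: (@continuous_comp _ _ _ (unproj A)); first exact: continuous_unproj.
by apply: (continuous_angular_integral kb); exact: unproj_gt0.
Qed.

End ProjectionSubstitution.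

Section IntegrationRanges.
Variables (R : realType) (a b c : R).
Hypotheses (ab : 0 <= a <= b) (bc : b <= c).

Let le_abc : [/\ 0 <= a, 0 <= b, 0 <= c, a <= b & b <= c].
Proof. by move: ab bc => /andP[a0 ab'] bc'; split=> //; lra. Qed.

Let xstar_abc : xstar (a ^+ 2) (b ^+ 2) (c ^+ 2) = b ^+ 2 + c ^+ 2 - a ^+ 2.
Proof. by rewrite xstarE//; have [] := le_abc; nra. Qed.

Let xstar_bac : xstar (b ^+ 2) (a ^+ 2) (c ^+ 2) = a ^+ 2 + c ^+ 2 - b ^+ 2.
Proof. by rewrite xstarE//; have [] := le_abc; nra. Qed.

Let sqrtE : [/\ Num.sqrt (a ^+ 2) = a, Num.sqrt (b ^+ 2) = b & Num.sqrt (c ^+ 2) = c].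
Proof. by have [a0 b0 c0 _ _] := le_abc; rewrite !sqrtr_sqr_ge0. Qed.

Let sqrtDB := sqrt_sqrDB_bounds ab bc.
Let sqrtBD := sqrt_sqrBD_bounds ab bc.

Lemma s_range_abc : smin (a ^+ 2) (b ^+ 2) (c ^+ 2) = b - a /\
  smax (a ^+ 2) (b ^+ 2) (c ^+ 2) = b + a.
Proof.
rewrite /smin /smax xstar_abc; have [-> -> ->] := sqrtE.
move: sqrtDB; set X := Num.sqrt _ => /andP[X_ge X_le]; have [a0 b0 c0 ab' bc'] := le_abc.
rewrite distrC !ger0_norm ?subr_ge0//; split; first by apply/max_idPl; lra.
by rewrite addrC; apply/min_idPl; lra.
Qed.

Lemma s_range_bac : smin (b ^+ 2) (a ^+ 2) (c ^+ 2) = b - a /\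
  smax (b ^+ 2) (a ^+ 2) (c ^+ 2) = b + a.
Proof.
rewrite /smin /smax xstar_bac; have [-> -> ->] := sqrtE.
move: sqrtBD; set X := Num.sqrt _ => /andP[X_ge X_le]; have [a0 b0 c0 ab' bc'] := le_abc.
rewrite ger0_norm ?subr_ge0// distrC ger0_norm ?subr_ge0//.
by split; [apply/max_idPl|apply/min_idPl]; lra.
Qed.

Lemma s_range_acb :
  smin (a ^+ 2) (c ^+ 2) (b ^+ 2) = unproj (c ^+ 2 - a ^+ 2) (- a) /\
  smax (a ^+ 2) (c ^+ 2) (b ^+ 2) = unproj (c ^+ 2 - a ^+ 2) a.
Proof.
rewrite /smin /smax /unproj sqrrN xstarC xstar_abc [a ^+ 2 + _]addrC subrK.
have [-> -> ->] := sqrtE.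
move: sqrtDB; set X := Num.sqrt _ => /andP[X_ge X_le]; have [a0 b0 c0 ab' bc'] := le_abc.
rewrite distrC !ger0_norm ?subr_ge0 1?addrC; try lra.
by split; [apply/max_idPl|apply/min_idPl]; lra.
Qed.

Lemma s_range_bca :
  smin (b ^+ 2) (c ^+ 2) (a ^+ 2) = unproj (c ^+ 2 - b ^+ 2) (- a) /\
  smax (b ^+ 2) (c ^+ 2) (a ^+ 2) = unproj (c ^+ 2 - b ^+ 2) a.
Proof.
rewrite /smin /smax /unproj sqrrN xstarC xstar_bac [a ^+ 2 + (_ - _)]addrA.
have [-> -> ->] := sqrtE.
move: sqrtBD; set X := Num.sqrt _ => /andP[X_ge X_le]; have [a0 b0 c0 ab' bc'] := le_abc.
rewrite distrC !ger0_norm ?subr_ge0; try lra.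
by rewrite (addrC (- a)) (addrC a X); split; [apply/max_idPr|apply/min_idPr]; lra.
Qed.

End IntegrationRanges.

Section KernelDifference.
Variables (R : realType) (phi : R -> R) (b0 q : R).
Hypothesis kb : kernel_bounds phi b0 q.
Let b0_ge0 := kernel_b0_ge0 kb.
Let q_ge0 := kernel_q_ge0 kb.
Implicit Types s h th : R.

Local Notation leb := (@lebesgue_measure R).

Variables a b c : R.
Hypotheses (ab : 0 <= a < b) (bc : 4 * b <= c).

Let le_abc : [/\ 0 <= a, 0 < b, 0 < c, a < b & 4 * b <= c].
Proof. by move: ab bc => /andP[a0 ab'] bc'; split=> //; lra. Qed.

(* At (a, b, c) and (b, a, c) the ranges of s agree and so does the second
   summand of Y_*; only the first summand u shrinks to u', with
   u^2 - u'^2 = b^2 - a^2. *)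
Lemma Ystar_abc_bac s th : b - a <= s <= b + a ->
  let Y := Ystar (a ^+ 2) (b ^+ 2) (c ^+ 2) s th in
  let Y' := Ystar (b ^+ 2) (a ^+ 2) (c ^+ 2) s th in
  [/\ c / 2 <= Y', Y' <= Y, (Y - Y') * c <= b ^+ 2 & Y + Y' <= 2 * (c + a)].
Proof.
move=> /andP[s_ge s_le]; have [a0 bp cp ab' bc'] := le_abc.
have s0 : 0 < s by lra.
rewrite !Ystar_modulus ?gt_eqF//.
have -> : proj (b ^+ 2) (a ^+ 2) s ^+ 2 = proj (a ^+ 2) (b ^+ 2) s ^+ 2 + (b ^+ 2 - a ^+ 2).
  by rewrite /proj; field; rewrite gt_eqF.
have -> : b ^+ 2 - (proj (a ^+ 2) (b ^+ 2) s ^+ 2 + (b ^+ 2 - a ^+ 2)) =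
  a ^+ 2 - proj (a ^+ 2) (b ^+ 2) s ^+ 2 by ring.
have [proj_ge proj_le] : - a <= proj (a ^+ 2) (b ^+ 2) s /\ proj (a ^+ 2) (b ^+ 2) s <= a.
  by rewrite /proj ler_pdivlMr ?ler_pdivrMr ?mulr_gt0//; split; nra.
have : 0 <= proj (a ^+ 2) (b ^+ 2) s ^+ 2 <= a ^+ 2 by rewrite sqr_ge0; nra.
move: (proj _ _ s ^+ 2) => P /andP[P0 Pa].
have B_ge : c ^+ 2 - b ^+ 2 <= c ^+ 2 - (P + (b ^+ 2 - a ^+ 2)) by lra.
have B_le : c ^+ 2 - (P + (b ^+ 2 - a ^+ 2)) <= c ^+ 2 - P by nra.
have A_le : c ^+ 2 - P <= c ^+ 2 by lra.
have [u'_ge u'u u_le du] := sqrt_sub_bounds (ltW bp) bc B_ge B_le A_le.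
rewrite !ge0_pos_part; try nra.
move: (Num.sqrt (c ^+ 2 - P)) (Num.sqrt (c ^+ 2 - (P + _))) u'_ge u'u u_le du => u u'.
move=> u'_ge u'u u_le du.
have v0 := sqrtr_ge0 (a ^+ 2 - P).
have v_le : Num.sqrt (a ^+ 2 - P) <= a by apply: sqrtr_le_of_sqr => //; lra.
move: (Num.sqrt _) v0 v_le => v v0 v_le.
have u'0 : 0 <= u' by lra.
have u0 : 0 <= u by lra.
have Y'_ge := modulus_geB th u'0 v0; have Y_le := modulus_leD th u0 v0.
have Y'_le := modulus_leD th u'0 v0; have dY := modulus_subl_le v th u'u.
split; [lra| |nra|lra].
by apply: le_modulusl => //; lra.
Qed.

Lemma angular_integral_abc_bac s : b - a <= s <= b + a ->
  angular_integral phi (a ^+ 2) (b ^+ 2) (c ^+ 2) s <=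
  angular_integral phi (b ^+ 2) (a ^+ 2) (c ^+ 2) s +
    10 * (q * b0 ^+ 2) * b ^+ 2 * (2 * pi).
Proof.
move=> sI; have [a0 bp cp ab' bc'] := le_abc; case/andP: (sI) => s_ge s_le.
have s0 : 0 < s by lra.
rewrite -[X in _ * X]subr0; apply: Rintegral_itv_leD_cst.
- by rewrite mulr_ge0// pi_ge0.
- by apply: (integrable_Phi_Ystar kb); rewrite gt_eqF.
- by apply: (integrable_Phi_Ystar kb); rewrite gt_eqF.
move=> th _; have [Y'_ge Y'Y dY Y_le] := Ystar_abc_bac th sI.
rewrite -lerBlDl; apply: (Phi_sqrt2_sub_le kb (c := c)) => //; lra.
Qed.

Lemma Ystar_acb_bca h th :
  Ystar (a ^+ 2) (c ^+ 2) (b ^+ 2) (unproj (c ^+ 2 - a ^+ 2) h) th =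
  Ystar (b ^+ 2) (c ^+ 2) (a ^+ 2) (unproj (c ^+ 2 - b ^+ 2) h) th.
Proof.
have [a0 bp cp ab' bc'] := le_abc.
have ca : 0 < c ^+ 2 - a ^+ 2 by nra.
have cb : 0 < c ^+ 2 - b ^+ 2 by nra.
by rewrite !Ystar_modulus ?gt_eqF ?unproj_gt0// !proj_unproj// modulusC.
Qed.

Let sqrt_acb_bca h : - a <= h <= a ->
  let A := h ^+ 2 + (c ^+ 2 - a ^+ 2) in let B := h ^+ 2 + (c ^+ 2 - b ^+ 2) in
  [/\ 3 / 4 * c <= Num.sqrt B, Num.sqrt B <= Num.sqrt A, Num.sqrt A <= c &
      (Num.sqrt A - Num.sqrt B) * c <= b ^+ 2].
Proof.
move=> /andP[h_ge h_le]; have [a0 bp cp ab' bc'] := le_abc.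
have hh : 0 <= h ^+ 2 <= a ^+ 2 by rewrite sqr_ge0; nra.
by apply: sqrt_sub_bounds => //; [exact: ltW|lra|nra|lra].
Qed.

Lemma unproj_acb_bca h : - a <= h <= a ->
  let s := unproj (c ^+ 2 - a ^+ 2) h in let s' := unproj (c ^+ 2 - b ^+ 2) h in
  [/\ c / 2 <= s', s' <= s, (s - s') * c <= b ^+ 2 & s <= c + a].
Proof.
move=> hI; case/andP: (hI) => h_ge h_le; rewrite /unproj; have [a0 bp cp ab' bc'] := le_abc.
have [B_sqrt BA A_sqrt dAB] := sqrt_acb_bca hI.
by split; lra.
Qed.

Lemma dunproj_acb_bca h : - a <= h <= a ->
  dunproj (c ^+ 2 - a ^+ 2) h <= 2 /\
  (dunproj (c ^+ 2 - a ^+ 2) h - dunproj (c ^+ 2 - b ^+ 2) h) * c ^+ 2 <= b ^+ 2.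
Proof.
move=> hI; case/andP: (hI) => h_ge h_le; rewrite /dunproj; have [a0 bp cp ab' bc'] := le_abc.
have [] := sqrt_acb_bca hI.
move: (Num.sqrt (h ^+ 2 + (c ^+ 2 - a ^+ 2))) (Num.sqrt _) => A B B_sqrt BA A_sqrt dAB.
have B0 : 0 < B by lra.
have A0 : 0 < A by lra.
split; first by rewrite -lerBrDl ler_pdivrMr//; lra.
have -> : (1 + h / A - (1 + h / B)) * c ^+ 2 = h * (B - A) * c ^+ 2 / (A * B).
  by field; rewrite !gt_eqF.
have AB_ge : 9 / 16 * c ^+ 2 <= A * B by nra.
have hBA : h * (B - A) <= 9 / 16 * b ^+ 2.
  have : h * (B - A) <= a * (A - B) by nra.
  have : a * (A - B) <= c * (A - B) / 4 by nra.
  by have := sqr_ge0 b; lra.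
rewrite ler_pdivrMr ?mulr_gt0//; apply: (le_trans (ler_wpM2r (sqr_ge0 c) hBA)).
by have := ler_wpM2l (sqr_ge0 b) AB_ge; lra.
Qed.

Lemma angular_integral_acb_bca h : - a <= h <= a ->
  angular_integral phi (a ^+ 2) (c ^+ 2) (b ^+ 2) (unproj (c ^+ 2 - a ^+ 2) h) <=
  angular_integral phi (b ^+ 2) (c ^+ 2) (a ^+ 2) (unproj (c ^+ 2 - b ^+ 2) h) +
    10 * (q * b0 ^+ 2) * b ^+ 2 * (2 * pi).
Proof.
move=> hI; have [a0 bp cp ab' bc'] := le_abc.
have [] := unproj_acb_bca hI; set s' := unproj _ h; set s := unproj _ h => s'_ge s's ds s_le.
rewrite -[X in _ * X]subr0; apply: Rintegral_itv_leD_cst.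
- by rewrite mulr_ge0// pi_ge0.
- by apply: (integrable_Phi_Ystar kb); rewrite gt_eqF//; lra.
- by apply: (integrable_Phi_Ystar kb); rewrite gt_eqF//; lra.
move=> th _; rewrite Ystar_acb_bca -lerBlDl ![Phi phi _ (_ * Ystar _ _ _ _ _)]PhiC.
have Y0 := Ystar_ge0 (b ^+ 2) (c ^+ 2) (a ^+ 2) s' th.
have Y_le : Ystar (b ^+ 2) (c ^+ 2) (a ^+ 2) s' th <= 2 * b.
  by apply: Ystar_le => //; [exact: ltW|nra].
by apply: (Phi_sqrt2_sub_le kb (c := c)) => //; lra.
Qed.

Lemma angular_integral_bca_le h : - a <= h <= a ->
  angular_integral phi (b ^+ 2) (c ^+ 2) (a ^+ 2) (unproj (c ^+ 2 - b ^+ 2) h) <=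
    16 * pi * b0 ^+ 2 * c ^+ 2.
Proof.
move=> hI; have [a0 bp cp ab' bc'] := le_abc; have [s'_ge s's _ s_le] := unproj_acb_bca hI.
have -> : 16 * pi * b0 ^+ 2 * c ^+ 2 = 2 * b0 ^+ 2 * (2 * c) ^+ 2 * (2 * pi) by ring.
apply: angular_integral_le => [|th]; first by rewrite !(sqr_ge0, mulr_ge0).
apply: (Phi_sqrt2_le kb); [lra|exact: Ystar_ge0|].
have : Ystar (b ^+ 2) (c ^+ 2) (a ^+ 2) (unproj (c ^+ 2 - b ^+ 2) h) th <= 2 * b.
  by apply: Ystar_le => //; [exact: ltW|nra].
by lra.
Qed.

Lemma angular_integral_dunproj_acb_bca h : - a <= h <= a ->
  angular_integral phi (a ^+ 2) (c ^+ 2) (b ^+ 2) (unproj (c ^+ 2 - a ^+ 2) h) *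
    dunproj (c ^+ 2 - a ^+ 2) h <=
  angular_integral phi (b ^+ 2) (c ^+ 2) (a ^+ 2) (unproj (c ^+ 2 - b ^+ 2) h) *
    dunproj (c ^+ 2 - b ^+ 2) h + 20 * (b0 ^+ 2 * (1 + q)) * b ^+ 2 * (2 * pi).
Proof.
move=> hI; have [a0 bp cp ab' bc'] := le_abc.
have ca : 0 < c ^+ 2 - a ^+ 2 by nra.
set I := angular_integral phi (a ^+ 2) _ _ _; set I' := angular_integral phi (b ^+ 2) _ _ _.
set J := dunproj (c ^+ 2 - a ^+ 2) h; set J' := dunproj (c ^+ 2 - b ^+ 2) h.
pose E := 10 * (q * b0 ^+ 2) * b ^+ 2 * (2 * pi).
have dI : I <= I' + E := angular_integral_acb_bca hI.
have I'_le : I' <= 16 * pi * b0 ^+ 2 * c ^+ 2 := angular_integral_bca_le hI.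
have I'0 : 0 <= I' := angular_integral_ge0 _ _ _ _ _.
have [J_le dJ] : J <= 2 /\ (J - J') * c ^+ 2 <= b ^+ 2 := dunproj_acb_bca hI.
have J0 : 0 <= J := ltW (dunproj_gt0 h ca).
have E0 : 0 <= E by rewrite !(sqr_ge0, mulr_ge0) ?pi_ge0.
have IJ : I * J <= I' * J + E * 2.
  apply: (le_trans (ler_wpM2r J0 dI)); rewrite mulrDl lerD2l.
  by rewrite ler_wpM2l.
have I'J : I' * (J - J') <= 16 * pi * b0 ^+ 2 * b ^+ 2.
  have c2 : 0 < c ^+ 2 by rewrite exprn_gt0.
  rewrite -(ler_pM2r c2) -[leLHS]mulrA; apply: (le_trans (ler_wpM2l I'0 dJ)).
  by have := ler_wpM2r (sqr_ge0 b) I'_le; move: (@pi R) => P; lra.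
have : 0 <= pi * b0 ^+ 2 * b ^+ 2 by rewrite !(sqr_ge0, mulr_ge0) ?pi_ge0.
by move: IJ I'J; rewrite /E; move: (@pi R) => P; lra.
Qed.

End KernelDifference.

Section KernelSwap.
Variables (R : realType) (phi : R -> R) (b0 q : R).
Hypothesis kb : kernel_bounds phi b0 q.
Let b0_ge0 := kernel_b0_ge0 kb.
Let q_ge0 := kernel_q_ge0 kb.

Local Notation leb := (@lebesgue_measure R).

Variables a b c : R.
Hypotheses (ab : 0 <= a < b) (bc : 4 * b <= c).

Let le_abc : [/\ 0 <= a, 0 < b, 0 < c, a < b & 4 * b <= c].
Proof. by move: ab bc => /andP[a0 ab'] bc'; split=> //; lra. Qed.

Let ab_le : 0 <= a <= b.
Proof. by case/andP: ab => -> /ltW. Qed.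

Let bc_le : b <= c.
Proof. by have [] := le_abc; lra. Qed.

Let sqr_abc : [/\ 0 <= a ^+ 2, a ^+ 2 < b ^+ 2 & b ^+ 2 < c ^+ 2].
Proof. by have [a0 bp cp ab' bc'] := le_abc; rewrite sqr_ge0; split=> //; nra. Qed.

Let xstar_gt0 (x y z : R) : x < y + z -> 0 < xstar x y z.
Proof. by move=> xyz; rewrite xstarE ?subr_gt0// ltW. Qed.

Let prefactor_sub_le (I I' K : R) : 0 < a -> 0 <= K ->
  I <= I' + K * b ^+ 2 * (2 * pi) * (2 * a) ->
  (4 * pi * (a * b * c))^-1 * I - (4 * pi * (a * b * c))^-1 * I' <= K / 4.
Proof.
move=> a0 K0; rewrite -lerBlDl -mulrBr => dI; have [_ bp cp _ bc'] := le_abc.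
have pi0 := pi_gt0 R.
rewrite ler_pdivrMl ?mulr_gt0//; apply: (le_trans dI).
have -> : 4 * pi * (a * b * c) * (K / 4) = K * b * (pi * a) * c by field.
have -> : K * b ^+ 2 * (2 * pi) * (2 * a) = K * b * (pi * a) * (4 * b) by ring.
by rewrite ler_wpM2l// !mulr_ge0// ltW.
Qed.

Let W_sqrE x y z : 0 < x -> 0 < y -> 0 < z -> 0 < xstar (x ^+ 2) (y ^+ 2) (z ^+ 2) ->
  x * y * z = a * b * c ->
  W phi (x ^+ 2) (y ^+ 2) (z ^+ 2) = (4 * pi * (a * b * c))^-1 *
    \int[leb]_(s in `[smin (x ^+ 2) (y ^+ 2) (z ^+ 2), smax (x ^+ 2) (y ^+ 2) (z ^+ 2)])
      angular_integral phi (x ^+ 2) (y ^+ 2) (z ^+ 2) s.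
Proof.
move=> x0 y0 z0 xs0 xyz; rewrite W_nondegenerateE ?exprn_gt0//.
by rewrite -!exprMn xyz sqrtr_sqr_ge0// -xyz !mulr_ge0// ltW.
Qed.

Lemma Phi_quot_sub_le :
  (Phi phi (Num.sqrt (2 * b ^+ 2)) (Num.sqrt (2 * c ^+ 2)) -
   Phi phi (Num.sqrt (2 * b ^+ 2)) (Num.sqrt (2 * (c ^+ 2 - b ^+ 2)))) /
    Num.sqrt (b ^+ 2 * c ^+ 2) <= 5 * (b0 ^+ 2 * (1 + q)).
Proof.
have [a0 bp cp ab' bc'] := le_abc; have [b_ge0 c_ge0] := (ltW bp, ltW cp).
have c2b2 : c ^+ 2 - b ^+ 2 <= c ^+ 2 by rewrite gerBl sqr_ge0.
have [d_ge d_le _ cd] := sqrt_sub_bounds b_ge0 bc (lexx _) c2b2 (lexx _).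
rewrite -exprMn !(sqrtrM _ (ler0n R 2)) !sqrtr_sqr_ge0 ?mulr_ge0// in d_ge d_le cd *.
rewrite ler_pdivrMr ?mulr_gt0//.
apply: (le_trans (Phi_sqrt2_sub_le kb (c := c) b_ge0 b_ge0 bc cp _ d_le cd _)); try lra.
have b0b_ge0 : 0 <= b0 ^+ 2 * b by rewrite mulr_ge0 ?sqr_ge0.
have qb0b_ge0 := mulr_ge0 q_ge0 b0b_ge0.
have := ler_wpM2l qb0b_ge0 bc'; have := mulr_ge0 qb0b_ge0 c_ge0.
by have := mulr_ge0 b0b_ge0 c_ge0; lra.
Qed.

Lemma W_abc_sub_bac_le :
  W phi (a ^+ 2) (b ^+ 2) (c ^+ 2) - W phi (b ^+ 2) (a ^+ 2) (c ^+ 2) <=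
    5 * (b0 ^+ 2 * (1 + q)).
Proof.
have [a0 bp cp ab' bc'] := le_abc.
have b0q_ge0 : 0 <= b0 ^+ 2 * (1 + q) by rewrite mulr_ge0 ?sqr_ge0// addr_ge0.
have [a2_ge0 a2b2 b2c2] := sqr_abc.
have [b2 c2] : 0 < b ^+ 2 /\ 0 < c ^+ 2 by split; rewrite exprn_gt0.
move: a0; rewrite le_eqVlt => /predU1P[aE|ap].
  by rewrite -aE expr0n/= W_x0// W_y0// b2c2 -mulrBl; exact: Phi_quot_sub_le.
have xs_abc : 0 < xstar (a ^+ 2) (b ^+ 2) (c ^+ 2) by apply: xstar_gt0; lra.
have xs_bac : 0 < xstar (b ^+ 2) (a ^+ 2) (c ^+ 2) by apply: xstar_gt0; lra.
have bac : b * a * c = a * b * c by ring.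
rewrite (W_sqrE ap bp cp)// (W_sqrE bp ap cp)//.
have [-> ->] := s_range_abc ab_le bc_le; have [-> ->] := s_range_bac ab_le bc_le.
apply: (@le_trans _ _ (10 * (q * b0 ^+ 2) / 4)); last first.
  by have := sqr_ge0 b0; have := mulr_ge0 q_ge0 (sqr_ge0 b0); lra.
apply: prefactor_sub_le => //; first by rewrite !(sqr_ge0, mulr_ge0).
have -> : 2 * a = b + a - (b - a) by ring.
have ba0 : 0 < b - a by rewrite subr_gt0.
apply: Rintegral_itv_leD_cst; first lra.
- exact: (integrable_angular_integral kb).
- exact: (integrable_angular_integral kb).
- by move=> s; exact: (angular_integral_abc_bac kb).
Qed.

Lemma W_acb_sub_bca_le :
  W phi (a ^+ 2) (c ^+ 2) (b ^+ 2) - W phi (b ^+ 2) (c ^+ 2) (a ^+ 2) <=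
    5 * (b0 ^+ 2 * (1 + q)).
Proof.
have [a0 bp cp ab' bc'] := le_abc.
have b0q_ge0 : 0 <= b0 ^+ 2 * (1 + q) by rewrite mulr_ge0 ?sqr_ge0// addr_ge0.
have [a2_ge0 a2b2 b2c2] := sqr_abc.
have [b2 c2] : 0 < b ^+ 2 /\ 0 < c ^+ 2 by split; rewrite exprn_gt0.
move: a0; rewrite le_eqVlt => /predU1P[aE|ap].
  rewrite -aE expr0n/= W_x0// W_z0// b2c2 (mulrC (c ^+ 2)) -mulrBl.
  by rewrite ![Phi phi _ (Num.sqrt (2 * b ^+ 2))]PhiC; exact: Phi_quot_sub_le.
have xs_acb : 0 < xstar (a ^+ 2) (c ^+ 2) (b ^+ 2) by apply: xstar_gt0; lra.
have xs_bca : 0 < xstar (b ^+ 2) (c ^+ 2) (a ^+ 2) by apply: xstar_gt0; lra.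
have [acb bca] : a * c * b = a * b * c /\ b * c * a = a * b * c by split; ring.
rewrite (W_sqrE ap cp bp)// (W_sqrE bp cp ap)//.
have [-> ->] := s_range_acb ab_le bc_le; have [-> ->] := s_range_bca ab_le bc_le.
have ca : 0 < c ^+ 2 - a ^+ 2 by lra.
have cb : 0 < c ^+ 2 - b ^+ 2 by lra.
have -> : 5 * (b0 ^+ 2 * (1 + q)) = 20 * (b0 ^+ 2 * (1 + q)) / 4 by field.
rewrite !(Rintegral_angular_unproj kb)//; apply: prefactor_sub_le => //.
  by rewrite mulr_ge0.
have -> : 2 * a = a - - a by ring.
apply: Rintegral_itv_leD_cst; first lra.
- exact: (integrable_angular_unproj kb).
- exact: (integrable_angular_unproj kb).
- by move=> h; exact: (angular_integral_dunproj_acb_bca kb).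
Qed.

End KernelSwap.

(** * Symmetrization of the cubic operator *)

Record test_function (R : realType) (f : R -> R) : Prop := {
  test_ge0 : forall x, 0 <= x -> 0 <= f x;
  test_le : forall x y, 0 <= x -> x <= y -> f y <= f x;
  test_convex : forall x y t, 0 <= x -> 0 <= y -> 0 <= t <= 1 ->
    f ((1 - t) * x + t * y) <= (1 - t) * f x + t * f y;
  test_sqrt_le : forall x y, 0 <= x -> x <= y ->
    Num.sqrt x * f x <= Num.sqrt y * f y }.

Section CollisionGain.
Variables (R : realType) (f : R -> R).
Hypothesis tf : test_function f.
Implicit Types x y z h w C M : R.

Lemma test_convex_inner x y z :
  0 <= x -> x <= y -> y <= z -> f y + f (x + z - y) <= f x + f z.
Proof.
move=> x0 xy yz; have [xz|xz] := eqVneq x z.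
  have -> : y = z by lra.
  by rewrite -xz addrK.
have xz' : 0 < z - x by rewrite subr_gt0 lt_neqAle xz (le_trans xy).
pose t := (y - x) / (z - x).
have t01 : 0 <= t <= 1.
  by rewrite /t divr_ge0 ?subr_ge0 ?(le_trans xy)//= ler_pdivrMr// mul1r lerD2r.
have t01' : 0 <= 1 - t <= 1 by move: t01; lra.
have tz : t * (z - x) = y - x by rewrite divfK// gt_eqF.
have z0 : 0 <= z by lra.
have := test_convex tf x0 z0 t01; have := test_convex tf x0 z0 t01'.
have -> : (1 - t) * x + t * z = y by lra.
have -> : (1 - (1 - t)) * x + (1 - t) * z = x + z - y by lra.
by lra.
Qed.

Lemma test_decrement_le x z h : 0 <= x -> 0 <= h -> 2 * h <= z -> 2 * x <= z ->
  (f (z - h) - f z) * z <= 2 * h * f x.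
Proof.
move=> x0 h0 hz xz; have z0 : 0 <= z by lra.
have fx := test_ge0 tf x0; have fz := test_ge0 tf z0.
have [->|zn0] := eqVneq z 0; first by rewrite mulr0 !mulr_ge0.
have zp : 0 < z by rewrite lt0r zn0.
have t01 : 0 <= 2 * h / z <= 1 by rewrite divr_ge0 ?mulr_ge0//= ler_pdivrMr// mul1r.
have z2 : 0 <= z / 2 by rewrite divr_ge0.
have := test_convex tf z0 z2 t01.
have -> : (1 - 2 * h / z) * z + 2 * h / z * (z / 2) = z - h by field.
have fz2 : f (z / 2) <= f x by apply: test_le tf _ _ x0 _; lra.
have -> : 2 * h * f x = 2 * h / z * f x * z by field.
rewrite ler_pM2r//; case/andP: t01; move: (2 * h / z) => t t0 t1; nra.
Qed.

Definition gain x y z : R := f x + f (xstar x y z) - f y - f z.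

Lemma KopE phi x y z : Kop phi f x y z = W phi x y z * gain x y z.
Proof. by []. Qed.

Lemma gainC x y z : gain x y z = gain x z y.
Proof. by rewrite /gain xstarC addrAC. Qed.

Lemma gain_eq0 x z : 0 <= x -> 0 <= z -> gain x x z = 0.
Proof.
move=> x0 z0; rewrite /gain xstarE ?lerDl// [x + z]addrC addrK; lra.
Qed.

Lemma gain_middle_le0 x y z : 0 <= x -> x <= y -> y <= z -> gain y x z <= 0.
Proof.
move=> x0 xy yz; rewrite /gain xstarE; last by lra.
by have := test_convex_inner x0 xy yz; lra.
Qed.

Lemma gain_min_le x y z : 0 <= x -> x <= y -> x <= z -> gain x y z <= f x.
Proof.
move=> x0 xy xz; rewrite /gain xstarE; last by lra.
have := test_ge0 tf (le_trans x0 xy).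
have : f (y + z - x) <= f z by apply: test_le tf _ _ _ _; lra.
by lra.
Qed.

Lemma gain_max_le x y z : 0 <= x -> 0 <= y -> x <= z ->
  gain z x y <= f (xstar z x y).
Proof.
move=> x0 y0 xz; rewrite /gain; have := test_le tf x0 xz; have := test_ge0 tf y0.
by lra.
Qed.

(* The positive part w (f x - f y) of the first term is compensated by the
   negative part of the second one, up to the difference of the weights. *)
Lemma gain_pair_le x y z w w' C M :
  0 <= x -> x <= y -> 0 < z -> 2 * y <= z -> 0 <= w -> 0 <= w' -> 0 <= C ->
  w - w' <= C -> w' * (2 * y) <= M * z ->
  w * gain x y z + w' * gain y x z <= (C + M) * f x.
Proof.
move=> x0 xy zp yz w0 w'0 C0 ww' w'M; have y0 : 0 <= y by lra.
have [fx fy] := (test_ge0 tf x0, test_ge0 tf y0).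
rewrite /gain !xstarE; try lra.
have fxy : 0 <= f x - f y by rewrite subr_ge0; exact: test_le.
have far : f (y + z - x) <= f z by apply: test_le tf _ _ _ _; lra.
have := @test_decrement_le x z (y - x) x0; rewrite (_ : z - (y - x) = x + z - y); last by ring.
set d := f (x + z - y) - f z => dz.
have w'd : w' * d <= M * f x.
  rewrite -(ler_pM2r zp) -mulrA; apply: (le_trans (ler_wpM2l w'0 (dz _ _ _))); try lra.
  by have := ler_wpM2r fx w'M; have := mulr_ge0 (mulr_ge0 w'0 x0) fx; lra.
have wd : (w - w') * (f x - f y) <= C * f x.
  by apply: (le_trans (ler_wpM2r fxy ww')); rewrite ler_wpM2l//; lra.
have wfar : w * (f (y + z - x) - f z) <= 0 by rewrite mulr_ge0_le0// subr_le0.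
by move: w'd wd wfar; rewrite /d; lra.
Qed.

End CollisionGain.

Section SymmetrizedKernel.
Variables (R : realType) (phi : R -> R) (b0 q : R) (f : R -> R).
Hypothesis kb : kernel_bounds phi b0 q.
Hypothesis tf : test_function f.
Let b0_ge0 := kernel_b0_ge0 kb.
Let q_ge0 := kernel_q_ge0 kb.
Implicit Types x y z a b c : R.

Lemma Kop_eq0 x z : 0 <= x -> 0 <= z ->
  [/\ Kop phi f x x z = 0 & Kop phi f x z x = 0].
Proof.
by move=> x0 z0; rewrite !KopE (gainC f x z x) gain_eq0// !mulr0.
Qed.

Lemma Kop_max_eq0 x y z : 0 <= x -> 0 <= y -> x + y <= z -> Kop phi f z x y = 0.
Proof.
move=> x0 y0 xyz; rewrite KopE /W xstar_eq0// !mul0r ltxx.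
have -> : (z < y) = false by apply/negbTE; rewrite -leNgt; lra.
have -> : (z < x) = false by apply/negbTE; rewrite -leNgt; lra.
have -> : [&& z == 0, 0 < x & 0 < y] = false.
  have [z0|//] := eqVneq z 0; apply/negbTE; rewrite /= negb_and -!leNgt.
  by apply/orP; left; lra.
by rewrite !andbF mul0r.
Qed.

Lemma Kop_middle_le0 x y z : 0 <= x -> x <= y -> y <= z ->
  Kop phi f y x z <= 0 /\ Kop phi f y z x <= 0.
Proof.
move=> x0 xy yz; rewrite !KopE (gainC f y z).
by split; rewrite mulr_ge0_le0 ?W_ge0// gain_middle_le0.
Qed.

Lemma Kop_min_le x y z M : 0 <= x -> x <= y -> x <= z ->
  W phi x y z <= M -> Kop phi f x y z <= M * f x.
Proof.
move=> x0 xy xz WM; rewrite KopE; apply: (@le_trans _ _ (W phi x y z * f x)).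
  by rewrite ler_wpM2l ?W_ge0// gain_min_le.
by rewrite ler_wpM2r// (test_ge0 tf).
Qed.

Lemma Kop_max_le x y z : 0 <= x <= z -> 0 <= y <= z -> z <= 4 * Num.max x y ->
  Kop phi f (z ^+ 2) (x ^+ 2) (y ^+ 2) <= 128 * b0 ^+ 2 * f (Num.min x y ^+ 2).
Proof.
move=> /andP[x0 xz] /andP[y0 yz] zM.
set m := Num.min x y; set M := Num.max x y in zM.
have rhs_ge0 : 0 <= 128 * b0 ^+ 2 * f (m ^+ 2).
  by rewrite !(sqr_ge0, mulr_ge0) ?(test_ge0 tf) ?sqr_ge0.
have [xE|xn0] := eqVneq x 0.
  by rewrite Kop_max_eq0 ?sqr_ge0// xE expr0n add0r ler_sqr ?nnegrE ?(le_trans y0).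
have [yE|yn0] := eqVneq y 0.
  by rewrite Kop_max_eq0 ?sqr_ge0// yE expr0n addr0 ler_sqr ?nnegrE ?(le_trans x0).
have [xp yp] : 0 < x /\ 0 < y by rewrite !lt0r xn0 yn0.
have zp : 0 < z by exact: lt_le_trans xz.
set xs := xstar (z ^+ 2) (x ^+ 2) (y ^+ 2).
have xs0 : 0 <= xs by exact: xstar_ge0.
have m0 : 0 <= m by rewrite le_min x0.
have xz2 : x ^+ 2 <= z ^+ 2 by rewrite ler_sqr// nnegrE ltW.
have yz2 : y ^+ 2 <= z ^+ 2 by rewrite ler_sqr// nnegrE ltW.
have xs_le : xs <= m ^+ 2.
  rewrite /xs /xstar; apply: pos_part_le; first exact: sqr_ge0.
  by rewrite /m; case: (leP x y) => _; lra.
have zzm : z ^+ 2 * m <= 4 * (z * x * y).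
  have -> : z * x * y = z * (m * M) by rewrite /m /M; case: leP => _; ring.
  by have := ler_wpM2l (mulr_ge0 (ltW zp) m0) zM; lra.
have zxy0 : 0 < z * x * y by rewrite !mulr_gt0.
rewrite KopE; apply: (@le_trans _ _ (W phi (z ^+ 2) (x ^+ 2) (y ^+ 2) * f xs)).
  by rewrite ler_wpM2l ?W_ge0// gain_max_le ?sqr_ge0.
rewrite -(ler_pM2r zxy0).
have fxs := test_ge0 tf xs0.
have zz : 0 <= z <= z by rewrite ltW//=.
have xz' : 0 <= x <= z by rewrite x0.
have yz' : 0 <= y <= z by rewrite y0.
have := ler_wpM2r fxs (W_sqr_mul_xyz_le kb zz xz' yz'); rewrite -/xs => Wxs.
have sqrt_xs : Num.sqrt xs * f xs <= m * f (m ^+ 2).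
  by rewrite -{1}(sqrtr_sqr_ge0 m0); exact: test_sqrt_le tf _ _ xs0 xs_le.
have c0 : 0 <= 32 * b0 ^+ 2 * z ^+ 2 by rewrite !(sqr_ge0, mulr_ge0).
have c1 : 0 <= 32 * b0 ^+ 2 * f (m ^+ 2) by rewrite !(sqr_ge0, mulr_ge0) ?(test_ge0 tf) ?sqr_ge0.
by have := ler_wpM2l c0 sqrt_xs; have := ler_wpM2l c1 zzm; lra.
Qed.

End SymmetrizedKernel.

Section SymmetrizedSum.
Variables (R : realType) (phi : R -> R) (b0 q : R) (f : R -> R).
Hypothesis kb : kernel_bounds phi b0 q.
Hypothesis tf : test_function f.
Let b0_ge0 := kernel_b0_ge0 kb.
Let q_ge0 := kernel_q_ge0 kb.
Implicit Types x y z a b c : R.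

Let b0q_ge0 : 0 <= b0 ^+ 2 * (1 + q).
Proof. by rewrite mulr_ge0 ?sqr_ge0// addr_ge0. Qed.

Let b0_le_b0q : b0 ^+ 2 <= b0 ^+ 2 * (1 + q).
Proof. by rewrite ler_peMr ?sqr_ge0// lerDl. Qed.

Definition Ksym x y z : R :=
  Kop phi f x y z + Kop phi f x z y + (Kop phi f y x z + Kop phi f y z x) +
  (Kop phi f z x y + Kop phi f z y x).

Lemma Ksym_comparable_le a b c : 0 <= a -> a <= b -> b <= c -> c < 4 * b ->
  Ksym (a ^+ 2) (b ^+ 2) (c ^+ 2) <= 512 * b0 ^+ 2 * f (a ^+ 2).
Proof.
move=> a0 ab bc c4b.
have [b_gt0 c_gt0] : 0 < b /\ 0 < c by split; lra.
have [a2b2 b2c2] : a ^+ 2 <= b ^+ 2 /\ b ^+ 2 <= c ^+ 2 by split; nra.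
have [ac bc' cc] : [/\ 0 <= a <= c, 0 <= b <= c & 0 <= c <= c] by split; lra.
have W_le w : w * (b * c) <= 32 * b0 ^+ 2 * c ^+ 2 -> w <= 128 * b0 ^+ 2.
  move=> wbc; rewrite -(@ler_pM2r _ (b * c)) ?mulr_gt0//; apply: (le_trans wbc).
  by have := sqr_ge0 b0; nra.
have Kabc : Kop phi f (a ^+ 2) (b ^+ 2) (c ^+ 2) <= 128 * b0 ^+ 2 * f (a ^+ 2).
  apply: (Kop_min_le tf); rewrite ?sqr_ge0//; first exact: le_trans b2c2.
  by apply: W_le; have [] := W_sqr_mul_le kb ac bc' cc.
have Kacb : Kop phi f (a ^+ 2) (c ^+ 2) (b ^+ 2) <= 128 * b0 ^+ 2 * f (a ^+ 2).
  apply: (Kop_min_le tf); rewrite ?sqr_ge0//; first exact: le_trans b2c2.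
  by apply: W_le; rewrite (mulrC b); have [] := W_sqr_mul_le kb ac cc bc'.
have [Kbac Kbca] := Kop_middle_le0 phi tf (sqr_ge0 a) a2b2 b2c2.
have minE : Num.min a b = a by apply/min_idPl.
have maxE : Num.max a b = b by apply/max_idPr.
have Kcab : Kop phi f (c ^+ 2) (a ^+ 2) (b ^+ 2) <= 128 * b0 ^+ 2 * f (a ^+ 2).
  by rewrite -{2}minE; apply: (Kop_max_le kb tf) => //; rewrite maxE ltW.
have Kcba : Kop phi f (c ^+ 2) (b ^+ 2) (a ^+ 2) <= 128 * b0 ^+ 2 * f (a ^+ 2).
  by rewrite -{2}minE minC; apply: (Kop_max_le kb tf) => //; rewrite maxC maxE ltW.
by rewrite /Ksym; lra.
Qed.

Lemma weight_separated_le b c w : 0 <= b -> 0 < c -> 4 * b <= c ->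
  w * (b * c) <= 32 * b0 ^+ 2 * c ^+ 2 ->
  w * (2 * b ^+ 2) <= 16 * (b0 ^+ 2 * (1 + q)) * c ^+ 2.
Proof.
move=> b_ge0 c_gt0 bc wbc; rewrite -(ler_pM2r c_gt0).
have -> : w * (2 * b ^+ 2) * c = w * (b * c) * (2 * b) by ring.
have b20 : 0 <= 2 * b by rewrite mulr_ge0.
apply: (le_trans (ler_wpM2r b20 wbc)).
have -> : 32 * b0 ^+ 2 * c ^+ 2 * (2 * b) = 16 * (b0 ^+ 2 * c ^+ 2) * (4 * b) by ring.
have -> : 16 * (b0 ^+ 2 * (1 + q)) * c ^+ 2 * c = 16 * (b0 ^+ 2 * (1 + q) * c ^+ 2) * c by ring.
apply: ler_pM => //; rewrite ?(sqr_ge0, mulr_ge0)//.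
by rewrite ler_wpM2l// ler_wpM2r ?sqr_ge0.
Qed.

Lemma gain_pair_separated_le a b c w w' : 0 <= a -> a <= b -> 0 < c -> 4 * b <= c ->
  0 <= w -> 0 <= w' -> w - w' <= 5 * (b0 ^+ 2 * (1 + q)) ->
  w' * (b * c) <= 32 * b0 ^+ 2 * c ^+ 2 ->
  w * gain f (a ^+ 2) (b ^+ 2) (c ^+ 2) + w' * gain f (b ^+ 2) (a ^+ 2) (c ^+ 2) <=
    21 * (b0 ^+ 2 * (1 + q)) * f (a ^+ 2).
Proof.
move=> a0 ab c_gt0 bc w0 w'0 ww' w'bc; have b_ge0 := le_trans a0 ab.
have -> : 21 * (b0 ^+ 2 * (1 + q)) = 5 * (b0 ^+ 2 * (1 + q)) + 16 * (b0 ^+ 2 * (1 + q)) by ring.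
have [a2b2 b2c2] : a ^+ 2 <= b ^+ 2 /\ 2 * b ^+ 2 <= c ^+ 2 by split; nra.
apply: (gain_pair_le tf); rewrite ?sqr_ge0 ?exprn_gt0//; first by rewrite mulr_ge0.
exact: weight_separated_le.
Qed.

Lemma Ksym_separated_le a b c : 0 <= a -> a <= b -> 4 * b <= c ->
  Ksym (a ^+ 2) (b ^+ 2) (c ^+ 2) <= 42 * (b0 ^+ 2 * (1 + q)) * f (a ^+ 2).
Proof.
move=> a0 ab bc; have [b_ge0 c_ge0] : 0 <= b /\ 0 <= c by split; lra.
have a2b2_le : a ^+ 2 + b ^+ 2 <= c ^+ 2 by nra.
rewrite /Ksym !(@Kop_max_eq0 _ phi f _ _ (c ^+ 2)) ?sqr_ge0 1?[b ^+ 2 + _]addrC//.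
move: ab; rewrite le_eqVlt => /predU1P[<-|ab].
  have [-> ->] := Kop_eq0 phi f (sqr_ge0 a) (sqr_ge0 c).
  by rewrite !addr0 mulr_ge0 ?(test_ge0 tf) ?sqr_ge0// mulr_ge0.
have c_gt0 : 0 < c by lra.
have [ac bc' cc] : [/\ 0 <= a <= c, 0 <= b <= c & 0 <= c <= c] by split; lra.
have ab' : 0 <= a < b by rewrite a0.
have pair_le w w' := @gain_pair_separated_le a b c w w' a0 (ltW ab) c_gt0 bc.
have [_ Wbac _] := W_sqr_mul_le kb bc' ac cc; have [Wbca _ _] := W_sqr_mul_le kb bc' cc ac.
have := pair_le _ _ (W_ge0 phi _ _ _) (W_ge0 phi _ _ _) (W_abc_sub_bac_le kb ab' bc) Wbac.
have := pair_le _ _ (W_ge0 phi _ _ _) (W_ge0 phi _ _ _) (W_acb_sub_bca_le kb ab' bc) Wbca.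
rewrite !KopE (gainC f (a ^+ 2) (c ^+ 2)) (gainC f (b ^+ 2) (c ^+ 2)); lra.
Qed.

Lemma Ksym_le x y z : 0 <= x -> 0 <= y -> 0 <= z ->
  Ksym x y z <= 512 * (b0 ^+ 2 * (1 + q)) * (f x + f y + f z).
Proof.
have sorted_le u v w : 0 <= u -> u <= v -> v <= w ->
    Ksym u v w <= 512 * (b0 ^+ 2 * (1 + q)) * (f u + f v + f w).
  move=> u0 uv vw; have v0 := le_trans u0 uv; have w0 := le_trans v0 vw.
  apply: (@le_trans _ _ (512 * (b0 ^+ 2 * (1 + q)) * f u)); last first.
    rewrite ler_wpM2l ?(mulr_ge0 (ler0n _ _) b0q_ge0)//.
    by rewrite -(addrA (f u)) lerDl addr_ge0 ?(test_ge0 tf).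
  rewrite -(sqr_sqrtr u0) -(sqr_sqrtr v0) -(sqr_sqrtr w0).
  have fu : 0 <= f (Num.sqrt u ^+ 2) := test_ge0 tf (sqr_ge0 _).
  have [suv svw] : Num.sqrt u <= Num.sqrt v /\ Num.sqrt v <= Num.sqrt w by rewrite !ler_wsqrtr.
  have [w4v|v4w] := ltP (Num.sqrt w) (4 * Num.sqrt v).
    apply: (le_trans (Ksym_comparable_le (sqrtr_ge0 _) suv svw w4v)).
    exact: ler_wpM2r fu _ _ (ler_wpM2l (ler0n _ _) b0_le_b0q).
  apply: (le_trans (Ksym_separated_le (sqrtr_ge0 _) suv v4w)).
  by rewrite ler_wpM2r// ler_wpM2r// ler_nat.
have s12 u v w : Ksym u v w = Ksym v u w by rewrite /Ksym; ring.
have s23 u v w : Ksym u v w = Ksym u w v by rewrite /Ksym; ring.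
wlog xy : x y z / x <= y => [le_case x0 y0 z0|].
  have [/le_case|/ltW/le_case] := leP x y; first exact.
  by rewrite s12 [f x + f y]addrC; exact.
move=> x0 y0 z0; have [yz|/ltW zy] := leP y z; first exact: sorted_le.
have [xz|/ltW zx] := leP x z.
  by rewrite s23 addrAC; exact: sorted_le.
by rewrite s23 s12 [f x + f y + f z]addrC addrA; exact: sorted_le.
Qed.

End SymmetrizedSum.

(** * Measurability of the kernel *)

Section MeasurableCombinators.
Context d (T : measurableType d) (R : realType).
Implicit Types f g : T -> R.

Lemma measurable_funV f : measurable_fun setT f -> measurable_fun setT (fun t => (f t)^-1).
Proof.
move=> mf; rewrite (_ : (fun t => _) = (fun t => f t * (f t ^+ 2) `^ (-1))).
  apply: measurable_funM => //.
  apply: (measurableT_comp (f := @powR R ^~ (-1))); first exact: measurable_powR.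
  exact: measurable_funX.
apply/funext => t; rewrite powR_inv1 ?sqr_ge0// expr2.
by have [->|ft0] := eqVneq (f t) 0; rewrite ?mul0r ?invr0//; field.
Qed.

Lemma measurable_continuous_comp (h : R -> R) f :
  continuous h -> measurable_fun setT f -> measurable_fun setT (fun t => h (f t)).
Proof. by move=> ch mf; apply: measurableT_comp => //; exact: continuous_measurable_fun. Qed.

Lemma measurable_sqrt f : measurable_fun setT f ->
  measurable_fun setT (fun t => Num.sqrt (f t)).
Proof. by apply: measurable_continuous_comp => ?; exact: sqrt_continuous. Qed.

Lemma measurable_pos_part f : measurable_fun setT f ->
  measurable_fun setT (fun t => pos_part (f t)).
Proof. by move=> mf; apply: (measurable_maxr mf); exact: measurable_cst. Qed.

Lemma measurable_modulus (u v th : T -> R) :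
  measurable_fun setT u -> measurable_fun setT v -> measurable_fun setT th ->
  measurable_fun setT (fun t => modulus (u t) (v t) (th t)).
Proof.
move=> mu mv mth.
have mcos : measurable_fun setT (fun t => cos (th t)).
  by apply: measurable_continuous_comp => // ?; exact: continuous_cos.
have msin : measurable_fun setT (fun t => sin (th t)).
  by apply: measurable_continuous_comp => // ?; exact: continuous_sin.
apply: measurable_sqrt; apply: measurable_funD; apply: measurable_funX.
- by apply: measurable_funD => //; exact: measurable_funM.
- exact: measurable_funM.
Qed.

Lemma measurable_Rintegral_section (f : T * R -> R) (l h : T -> R) :
  measurable_fun setT f -> measurable_fun setT l -> measurable_fun setT h ->
  (forall p, 0 <= f p) ->
  measurable_fun setT (fun t => \int[lebesgue_measure]_(s in `[l t, h t]) f (t, s)).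
Proof.
move=> mf ml mh f0.
pose in_range (p : T * R) := l p.1 <= p.2 <= h p.1.
have mr : measurable_fun setT in_range.
  apply: measurable_and; apply: measurable_fun_ler => //.
  - exact: (measurableT_comp ml measurable_fst).
  - exact: (measurableT_comp mh measurable_fst).
pose g p := ((if in_range p then f p else 0)%:E : \bar R).
rewrite (_ : (fun t => _) = fine \o (fubini_F lebesgue_measure g)); last first.
  apply/funext => t; rewrite /= /Rintegral /fubini_F; congr fine.
  rewrite integral_mkcond; apply: eq_integral => s _; rewrite patchE /g.
  by rewrite mem_setE in_itv/= /in_range; case: ifP.
apply: measurableT_comp => //.
apply: measurable_fun_fubini_tonelli_F => [|p]; last by rewrite /g lee_fin; case: ifP.
by apply/measurable_EFinP; exact: measurable_fun_ifT.
Qed.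

End MeasurableCombinators.

Section KernelMeasurability.
Variables (R : realType) (phi : R -> R) (b0 q : R).
Hypothesis kb : kernel_bounds phi b0 q.

Lemma measurable_Phi d (T : measurableType d) (f g : T -> R) :
  measurable_fun setT f -> measurable_fun setT g ->
  measurable_fun setT (fun t => Phi phi (f t) (g t)).
Proof.
move=> mf mg; apply: measurable_funX.
by apply: measurable_funD; apply: measurable_continuous_comp => //; exact: kernel_continuous kb.
Qed.

Lemma measurable_Ystar d (T : measurableType d) (x y z s th : T -> R) :
  measurable_fun setT x -> measurable_fun setT y -> measurable_fun setT z ->
  measurable_fun setT s -> measurable_fun setT th ->
  measurable_fun setT (fun t => Ystar (x t) (y t) (z t) (s t) (th t)).
Proof.
move=> mx my mz ms mth.
have mproj : measurable_fun setT (fun t => proj (x t) (y t) (s t)).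
  apply: measurable_funM.
    by apply: measurable_funD; [exact: measurable_funB|exact: measurable_funX].
  by apply: measurable_funV; apply: measurable_funM => //; exact: measurable_cst.
rewrite (_ : (fun t => _) = fun t => if s t == 0 then 0 else
    modulus (Num.sqrt (pos_part (z t - proj (x t) (y t) (s t) ^+ 2)))
            (Num.sqrt (pos_part (x t - proj (x t) (y t) (s t) ^+ 2))) (th t)); last first.
  apply/funext => t; have [->|st0] := eqVneq (s t) 0; first by rewrite /Ystar eqxx.
  by rewrite Ystar_modulus.
apply: measurable_fun_ifT.
- by apply: measurable_fun_eqr => //; exact: measurable_cst.
- exact: measurable_cst.
- by apply: measurable_modulus => //; apply: measurable_sqrt; apply: measurable_pos_part;
    apply: measurable_funB => //; exact: measurable_funX.
Qed.

Lemma measurable_angular_integral d (T : measurableType d) (x y z s : T -> R) :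
  measurable_fun setT x -> measurable_fun setT y -> measurable_fun setT z ->
  measurable_fun setT s ->
  measurable_fun setT (fun t => angular_integral phi (x t) (y t) (z t) (s t)).
Proof.
move=> mx my mz ms.
have m1 (f : T -> R) : measurable_fun setT f -> measurable_fun setT (fun p : T * R => f p.1).
  by move=> mf; exact: (measurableT_comp mf measurable_fst).
apply: (@measurable_Rintegral_section _ _ _ (fun p => Phi phi (Num.sqrt 2 * s p.1)
  (Num.sqrt 2 * Ystar (x p.1) (y p.1) (z p.1) (s p.1) p.2)) (fun=> 0) (fun=> 2 * pi)).
- apply: measurable_Phi; apply: measurable_funM; first exact: measurable_cst.
  + exact: m1.
  + exact: measurable_cst.
  + by apply: measurable_Ystar; try exact: m1; exact: measurable_snd.
- exact: measurable_cst.
- exact: measurable_cst.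
- by move=> p; exact: Phi_ge0.
Qed.

Section KernelCompositions.
Context d (T : measurableType d).
Variables x y z : T -> R.
Hypotheses (mx : measurable_fun setT x) (my : measurable_fun setT y).
Hypothesis mz : measurable_fun setT z.

Lemma measurable_xstar : measurable_fun setT (fun t => xstar (x t) (y t) (z t)).
Proof. by apply: measurable_pos_part; apply: measurable_funB => //; exact: measurable_funD. Qed.

Lemma measurable_smin : measurable_fun setT (fun t => smin (x t) (y t) (z t)).
Proof.
apply: measurable_maxr; apply: measurableT_comp => //; apply: measurable_funB;
  apply: measurable_sqrt => //; exact: measurable_xstar.
Qed.

Lemma measurable_smax : measurable_fun setT (fun t => smax (x t) (y t) (z t)).
Proof.
apply: measurable_minr; apply: measurable_funD; apply: measurable_sqrt => //.
exact: measurable_xstar.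
Qed.

Lemma measurable_W_nondegenerate : measurable_fun setT (fun t =>
  (4 * pi * Num.sqrt (x t * y t * z t))^-1 *
    \int[lebesgue_measure]_(s in `[smin (x t) (y t) (z t), smax (x t) (y t) (z t)])
      angular_integral phi (x t) (y t) (z t) s).
Proof.
apply: measurable_funM.
  apply: measurable_funV; apply: measurable_funM; first exact: measurable_cst.
  by apply: measurable_sqrt; do 2! [apply: measurable_funM => //].
have m1 (f : T -> R) : measurable_fun setT f -> measurable_fun setT (fun p : T * R => f p.1).
  by move=> mf; exact: (measurableT_comp mf measurable_fst).
apply: (@measurable_Rintegral_section _ _ _
  (fun p => angular_integral phi (x p.1) (y p.1) (z p.1) p.2)).
- by apply: measurable_angular_integral; try exact: m1; exact: measurable_snd.
- exact: measurable_smin.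
- exact: measurable_smax.
- by move=> p; exact: angular_integral_ge0.
Qed.

Lemma measurable_W : measurable_fun setT (fun t => W phi (x t) (y t) (z t)).
Proof.
have mPhi (u v r s : T -> R) : measurable_fun setT u -> measurable_fun setT v ->
    measurable_fun setT r -> measurable_fun setT s -> measurable_fun setT (fun t =>
      Phi phi (Num.sqrt (2 * u t)) (Num.sqrt (2 * v t)) / Num.sqrt (r t * s t)).
  move=> mu mv mr ms; apply: measurable_funM.
    by apply: measurable_Phi; apply: measurable_sqrt; exact: measurable_funM.
  by apply: measurable_funV; apply: measurable_sqrt; exact: measurable_funM.
have mlt (u v : T -> R) : measurable_fun setT u -> measurable_fun setT v ->
  measurable_fun setT (fun t => u t < v t) by move=> mu mv; exact: measurable_fun_ltr.
have mguard (u v w r : T -> R) : measurable_fun setT u -> measurable_fun setT v ->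
    measurable_fun setT w -> measurable_fun setT r ->
    measurable_fun setT (fun t => [&& u t == 0, 0 < v t & w t < r t]).
  move=> mu mv mw mr; apply: measurable_and; first exact: measurable_fun_eqr.
  by apply: measurable_and; exact: mlt.
have mB (u v : T -> R) : measurable_fun setT u -> measurable_fun setT v ->
  measurable_fun setT (fun t => u t - v t) by move=> mu mv; exact: measurable_funB.
apply: measurable_fun_ifT; last apply: measurable_fun_ifT; last apply: measurable_fun_ifT;
  last apply: measurable_fun_ifT => //.
- by apply: mlt => //; do 3! [apply: measurable_funM => //]; exact: measurable_xstar.
- exact: measurable_W_nondegenerate.
- exact: mguard.
- exact: mPhi.
- exact: mguard.
- by apply: mPhi => //; exact: mB.
- exact: mguard.
- by apply: mPhi => //; exact: mB.
Qed.

Lemma measurable_Kop (f : R -> R) : measurable_fun setT f ->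
  measurable_fun setT (fun t => Kop phi f (x t) (y t) (z t)).
Proof.
move=> mf; apply: measurable_funM; first exact: measurable_W.
have mfc (u : T -> R) : measurable_fun setT u -> measurable_fun setT (fun t => f (u t)).
  exact: measurableT_comp.
apply: measurable_funB; last exact: mfc.
apply: measurable_funB; last exact: mfc.
by apply: measurable_funD; [exact: mfc|apply: mfc; exact: measurable_xstar].
Qed.

End KernelCompositions.

End KernelMeasurability.

(** * The quadratic term *)

Lemma reg_power_test_function (R : realType) (p e : R) :
  0 < p -> p <= 2^-1 -> 0 < e -> test_function (reg_power p e).
Proof.
move=> p0 p_le e0; split.
- by move=> x _; exact: reg_power_ge0.
- by move=> x y; exact: reg_power_le.
- by move=> x y t; exact: reg_power_convex.
- by move=> x y; exact: sqrt_mul_reg_power_le.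
Qed.

Section QuadraticTerm.
Variables (R : realType) (phi : R -> R) (b0 q : R).
Hypothesis kb : kernel_bounds phi b0 q.
Implicit Types x y z : R.

Lemma Kop_mul_sqrt_le (f : R -> R) x y z :
  (forall x, 0 <= x -> 0 <= f x) -> 0 <= x -> 0 <= y -> 0 <= z -> x <= y + z -> 0 < y + z ->
  Kop phi f x y z * Num.sqrt x <=
    8 * b0 ^+ 2 / Num.sqrt (y + z) * (f x + f (y + z - x)).
Proof.
move=> f0 x0 y0 z0 xyz yz0; have sqrt_gt0 : 0 < Num.sqrt (y + z) by rewrite sqrtr_gt0.
have gain_le : gain f x y z <= f x + f (y + z - x).
  by rewrite /gain xstarE//; have := f0 y y0; have := f0 z z0; lra.
have g0 : 0 <= f x + f (y + z - x) by rewrite addr_ge0 ?f0 ?subr_ge0.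
rewrite KopE mulrAC; apply: (@le_trans _ _ (W phi x y z * Num.sqrt x * (f x + f (y + z - x)))).
  by rewrite ler_wpM2l// mulr_ge0 ?W_ge0 ?sqrtr_ge0.
by rewrite ler_wpM2r// ler_pdivlMr// (W_mul_sqrtD_le kb).
Qed.

Variables p e : R.
Hypotheses (p_gt0 : 0 < p) (p_le : p <= 2^-1) (e_gt0 : 0 < e).
Local Notation f := (reg_power p e).

Lemma Jop_reg_power_le y z : 0 <= y -> 0 <= z ->
  Jop phi f y z <= 16 * b0 ^+ 2 * (y + z) `^ (2^-1 - p).
Proof.
move=> y0 z0; rewrite /Jop; set S := y + z.
have [S0|Sn0] := eqVneq S 0.
  by rewrite S0 set_itv1 Rintegral_set1 mulr0 mulr_ge0 ?powR_ge0// mulr_ge0 ?sqr_ge0.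
have S_gt0 : 0 < S by rewrite lt0r Sn0 addr_ge0.
have sqrtS_gt0 : 0 < Num.sqrt S by rewrite sqrtr_gt0.
pose c := 8 * b0 ^+ 2 / Num.sqrt S; pose g x := f x + f (S - x).
have c0 : 0 <= c by rewrite divr_ge0 ?(ltW sqrtS_gt0)// mulr_ge0 ?sqr_ge0.
have g0 x : 0 <= g x by rewrite addr_ge0 ?reg_power_ge0.
have p1 : p < 1 by have := p_le; lra.
have cg := integral_mul_reg_powerD_reflect_le p_gt0 e_gt0 c0 p1 (ltW S_gt0).
apply: (@le_trans _ _ (2^-1 * \int[lebesgue_measure]_(x in `[0, S]) (c * g x))).
  rewrite ler_wpM2l//; apply: le_Rintegral_nonmeasurable.
  - by move=> x _; rewrite mulr_ge0.
  - move=> x /=; rewrite in_itv/= => /andP[x0 xS].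
    by apply: Kop_mul_sqrt_le => // u _; exact: reg_power_ge0.
  - by rewrite (le_lt_trans cg)// ltry.
apply: (@le_trans _ _ (2^-1 * (c * (2 / (1 - p) * S `^ (1 - p))))).
  rewrite ler_wpM2l// -lee_fin fineK// ge0_fin_numE; first by rewrite (le_lt_trans cg)// ltry.
  by apply: integral_ge0 => x _; rewrite lee_fin mulr_ge0.
have -> : S `^ (1 - p) = Num.sqrt S * S `^ (2^-1 - p).
  rewrite -powR12_sqrt ?(ltW S_gt0)// -powRD; last by rewrite Sn0 implybT.
  by congr (_ `^ _); field.
have -> : 2^-1 * (c * (2 / (1 - p) * (Num.sqrt S * S `^ (2^-1 - p)))) =
    8 * b0 ^+ 2 * S `^ (2^-1 - p) / (1 - p).
  by rewrite /c; field; rewrite gt_eqF ?subr_gt0// gt_eqF.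
rewrite ler_pdivrMr ?subr_gt0//.
have : 0 <= b0 ^+ 2 * S `^ (2^-1 - p) by rewrite mulr_ge0 ?powR_ge0 ?sqr_ge0.
by have := p_le; nra.
Qed.

End QuadraticTerm.

(** * Consequences of the kernel assumption *)

Section KernelAssumption.
Variables (R : realType) (phi k dk : R -> R) (b0 eta : R).
Hypothesis phiP : kernel_assumption phi b0 eta k dk.

(* The hypotheses on phi concern [0, +oo[ only; this extension is continuous on
   the whole line and defines the same kernel W. *)
Definition phi_ext (r : R) : R := phi (Num.max r 0).

Lemma phi_extE r : 0 <= r -> phi_ext r = phi r.
Proof. by move=> r0; rewrite /phi_ext max_l. Qed.

Lemma continuous_phi_ext : continuous phi_ext.
Proof.
have [cphi _] := phiP; move=> r.
have max_Rge0 (s : R) : Rge0 (Num.max s 0) by apply/Rge0P; rewrite le_max lexx orbT.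
have max_cvg : Num.max s 0 @[s --> r] --> within (@Rge0 R) (nbhs (Num.max r 0)).
  move=> P RP.
  have cmax : {for r, continuous (fun s : R => Num.max s 0)}.
    by apply: (@continuous_max _ _ id (fun=> 0)); [exact: cvg_id|exact: cvg_cst].
  have near_r : \forall s \near r, Rge0 (Num.max s 0) -> P (Num.max s 0) := cmax _ RP.
  suff : \forall s \near r, P (Num.max s 0) by [].
  by apply: filterS near_r => s; apply.
move/subspace_continuousP/(_ _ (max_Rge0 r)) : cphi.
exact: cvg_comp max_cvg.
Qed.

Let I12 : set R := `[1, Num.sqrt 2].

Let sqrt2_ge1 : 1 <= Num.sqrt 2 :> R.
Proof. by rewrite -{1}sqrtr1 ler_wsqrtr// ler1n. Qed.

Lemma within_continuous_k : {within I12, continuous k}.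
Proof.
have [_ [_ [_ [_ [_ [dkP _]]]]]] := phiP.
by apply/subspace_continuousP => x /dkP; exact: deriv_within_continuous.
Qed.

Lemma q1_ubound x : I12 x -> Num.max (2 * k x * dk x) 0 <= q1 k dk.
Proof.
have [_ [_ [_ [_ [_ [_ [cdk _]]]]]]] := phiP; move=> xI.
apply: ub_le_sup; last by exists x.
have cont : {within I12, continuous (fun x => 2 * k x * dk x)}.
  move=> y; apply: cvgM; last exact: cdk.
  by apply: cvgM; [exact: cvg_cst|exact: within_continuous_k].
have [z _ zmax] := EVT_max sqrt2_ge1 cont.
exists (Num.max (2 * k z * dk z) 0) => _ [y yI <-].
by rewrite ge_max !le_max lexx orbT andbT zmax.
Qed.

Lemma q1_ge0 : 0 <= q1 k dk.
Proof.
have I1 : I12 1 by rewrite /I12/= in_itv/= lexx.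
by apply: le_trans (q1_ubound I1); rewrite le_max lexx orbT.
Qed.

Let is_derive_sqr_k t x : t <= Num.sqrt 2 -> x \in `]1, t[ ->
  is_derive x 1 (fun x => k x ^+ 2) (2 * k x * dk x).
Proof.
have [_ [_ [_ [_ [_ [dkP _]]]]]] := phiP; move=> t2 xI.
have sub y : y \in `]1, t[ -> I12 y.
  by rewrite /I12/= !in_itv/= => /andP[/ltW-> /ltW/le_trans->].
have nbhs_x : nbhs x I12 by apply: filterS (near_in_itvoo xI) => y; exact: sub.
have kx := deriv_within_is_derive nbhs_x (dkP _ (sub _ xI)).
by apply: is_derive_eq; rewrite /GRing.scale/=; ring.
Qed.

Lemma k_le t : 1 <= t <= Num.sqrt 2 -> k t <= 1 + q1 k dk * (t - 1).
Proof.
have [_ [_ [_ [_ [_ [_ [_ [k1 _]]]]]]]] := phiP; move=> /andP[t1 t2].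
have ck : {within `[1, t], continuous (fun x => k x ^+ 2)}.
  have sub : `[1, t] `<=` I12.
    by move=> x; rewrite /I12/= !in_itv/= => /andP[-> /le_trans->].
  have ck := continuous_subspaceW sub within_continuous_k.
  by move=> x; apply: cvgM; exact: ck.
have [x xI kE] := MVT_segment t1 (fun x => is_derive_sqr_k t2) ck.
have qx : 2 * k x * dk x <= q1 k dk.
  apply: (@le_trans _ _ (Num.max (2 * k x * dk x) 0)); first by rewrite le_max lexx.
  apply: q1_ubound; move: xI; rewrite /I12/= !in_itv/= => /andP[-> xt].
  exact: le_trans xt t2.
have t10 : 0 <= t - 1 by rewrite subr_ge0.
have kt2 : k t ^+ 2 <= 1 + q1 k dk * (t - 1).
  by have := ler_wpM2r t10 qx; move: kE; rewrite k1 expr1n; lra.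
have q0 := mulr_ge0 q1_ge0 t10.
have [kt1|kt1] := leP (k t) 1; first by lra.
by apply: le_trans kt2; nra.
Qed.

Lemma phi_ext_kernel_bounds : kernel_bounds phi_ext b0 (q1 k dk).
Proof.
have [_ [_ [b0_gt0 [eta1 [phib [_ [_ [_ phik]]]]]]]] := phiP.
have max_ge0 s : 0 <= Num.max s 0 :> R by rewrite le_max lexx orbT.
have quot_le1 (s : R) : 0 <= s -> s / (1 + s) <= 1.
  by move=> s0; rewrite ler_pdivrMr; lra.
have quot_le (s : R) : 0 <= s -> s / (1 + s) <= s.
  by move=> s0; rewrite ler_pdivrMr; nra.
split.
- exact: continuous_phi_ext.
- exact: ltW.
- exact: q1_ge0.
- by move=> r; have /andP[] := phib _ (max_ge0 r).
- move=> r; have /andP[_ /le_trans] := phib _ (max_ge0 r); apply.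
  by rewrite ger_pMr// quot_le1// powR_ge0.
- move=> r r0; rewrite phi_extE//; have /andP[_ /le_trans] := phib _ r0; apply.
  rewrite ler_pM2l//; have [r1|/ltW r1] := leP r 1; last first.
    by apply: le_trans r1; exact/quot_le1/powR_ge0.
  apply: (le_trans (quot_le _ (powR_ge0 _ _))).
  move: r0; rewrite le_eqVlt => /predU1P[<-|r0].
    by rewrite powR0// gt_eqF// (lt_le_trans ltr01).
  by apply: ge1r_powR => //; rewrite r0.
- move=> r t r0 /andP[t1 t2].
  have t0 : 0 < t by exact: lt_le_trans ltr01 t1.
  have phir0 : 0 <= phi r by have /andP[] := phib _ (ltW r0).
  rewrite !phi_extE ?mulr_ge0 ?(ltW r0) ?(ltW t0)//.
  move: (t1); rewrite le_eqVlt => /predU1P[<-|t_gt1].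
    by rewrite mul1r subrr mulr0 addr0 mul1r.
  apply: (@le_trans _ _ (k t * phi r)); first by rewrite phik// t_gt1.
  by rewrite ler_wpM2r// k_le// t1.
Qed.

Lemma W_phi_ext x y z : W phi_ext x y z = W phi x y z.
Proof.
have PhiE r rho : 0 <= r -> 0 <= rho -> Phi phi_ext r rho = Phi phi r rho.
  by move=> r0 rho0; rewrite /Phi !phi_extE.
rewrite /W; case: ifP => _; last by rewrite !PhiE ?sqrtr_ge0.
congr (_ * _); apply: eq_Rintegral => s; rewrite inE/= in_itv/= => /andP[s_ge _].
have s0 : 0 <= s by apply: le_trans s_ge; rewrite le_max normr_ge0.
apply: eq_Rintegral => th _; apply: PhiE; rewrite mulr_ge0 ?sqrtr_ge0//.
exact: Ystar_ge0.
Qed.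

Lemma Kop_phi_ext f x y z : Kop phi_ext f x y z = Kop phi f x y z.
Proof. by rewrite /Kop W_phi_ext. Qed.

Lemma Jop_phi_ext f y z : Jop phi_ext f y z = Jop phi f y z.
Proof.
by rewrite /Jop; congr (_ * _); apply: eq_Rintegral => x _; rewrite Kop_phi_ext.
Qed.

End KernelAssumption.

(** * Moments of a solution *)

Section ProductTerms.
Variables (R : realType) (phi k dk : R -> R) (b0 eta p e : R).
Hypothesis phiP : kernel_assumption phi b0 eta k dk.
Hypotheses (p_gt0 : 0 < p) (p_le : p <= 2^-1) (e_gt0 : 0 < e).
Variable mu : {finite_measure set R -> \bar R}.
Local Notation D := (@Rge0 R).
Local Notation f := (reg_power p e).
Let N : R := fine (mu D).
Let kb := phi_ext_kernel_bounds phiP.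

Let mD : measurable D.
Proof. exact: measurable_itv. Qed.

Let NE : mu D = N%:E.
Proof. by rewrite fineK// fin_num_measure. Qed.

Lemma integral_reg_power_lty : (\int[mu]_(x in D) (f x)%:E < +oo)%E.
Proof.
apply: (@le_lt_trans _ _ (\int[mu]_(x in D) (e `^ (- p))%:E)%E).
  apply: ge0_le_integral_nonmeasurable => x /Rge0P x0; rewrite lee_fin ?reg_power_ge0//.
  by rewrite le_powRN ?lerDr// ltW.
by rewrite (integral_cst _ mD (e `^ (- p))%:E) [X in (_ * X)%E]NE -EFinM ltry.
Qed.

Lemma cubic_term_le :
  \int[((mu \x mu) \x mu)%E]_(w in (D `*` D) `*` D) Kop phi f w.1.1 w.1.2 w.2
  <= 256 * (b0 ^+ 2 * (1 + q1 k dk)) * (N ^+ 2 * \int[mu]_(x in D) f x).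
Proof.
have tf := reg_power_test_function p_gt0 p_le e_gt0.
have C_ge0 : 0 <= 512 * (b0 ^+ 2 * (1 + q1 k dk)).
  by rewrite mulr_ge0// mulr_ge0 ?sqr_ge0// addr_ge0// (kernel_q_ge0 kb).
have -> : 256 * (b0 ^+ 2 * (1 + q1 k dk)) = 512 * (b0 ^+ 2 * (1 + q1 k dk)) / 2 by field.
apply: (Rintegral_le_symmetrized3 mD) => //.
- under eq_fun do rewrite -Kop_phi_ext.
  apply: (measurable_Kop kb); last exact: measurable_reg_power.
  + exact: (measurableT_comp measurable_fst measurable_fst).
  + exact: (measurableT_comp measurable_snd measurable_fst).
  + exact: measurable_snd.
- exact: measurable_funTS (measurable_reg_power p e).
- by move=> x _; exact: reg_power_ge0.
- exact: integral_reg_power_lty.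
- move=> x y z /Rge0P x0 /Rge0P y0 /Rge0P z0; rewrite -!(Kop_phi_ext phi).
  exact: (Ksym_le kb tf).
Qed.

Hypothesis energy_lty : (\int[mu]_(x in D) x%:E < +oo)%E.
Let E : R := \int[mu]_(x in D) x.

Let N_ge0 : 0 <= N.
Proof. exact: fine_ge0. Qed.

Lemma integral_powR_half_sub_le :
  (\int[mu]_(x in D) (x `^ (2^-1 - p))%:E <= (E `^ (2^-1 - p) * N `^ (2^-1 + p))%:E)%E.
Proof.
have r01 : 0 <= 2^-1 - p <= 1 by have := p_gt0; have := p_le; lra.
have D0 x : D x -> 0 <= x by move/Rge0P.
have mid : measurable_fun D (fun x : R => x) by exact: measurable_id.
have EE : (\int[mu]_(x in D) x%:E = E%:E)%E by rewrite fineK// ge0_fin_numE// integral_ge0.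
apply: (le_trans (integral_powR_le mu mD mid D0 r01)).
rewrite EE [X in (_ * X `^ _)%E]NE -EFinM (_ : 1 - (2^-1 - p) = 2^-1 + p) //.
by field.
Qed.

Lemma quadratic_term_le :
  \int[(mu \x mu)%E]_(w in D `*` D) Jop phi f w.1 w.2
  <= 32 * b0 ^+ 2 * (N `^ (3 / 2 + p) * E `^ (2^-1 - p)).
Proof.
pose r := 2^-1 - p; pose g x := 16 * b0 ^+ 2 * x `^ r.
have c0 : 0 <= 16 * b0 ^+ 2 by rewrite mulr_ge0 ?sqr_ge0.
have g0 x : D x -> (0 <= (g x)%:E)%E.
  by move=> _; rewrite lee_fin mulr_ge0 ?powR_ge0.
have mg : measurable_fun D (fun x => (g x)%:E).
  apply/measurable_EFinP; apply: measurable_funTS; apply: measurable_funM.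
    exact: measurable_cst.
  exact: measurable_powR.
have G_le : (\int[mu]_(x in D) (g x)%:E <= (16 * b0 ^+ 2 * (E `^ r * N `^ (2^-1 + p)))%:E)%E.
  under eq_integral do rewrite EFinM.
  rewrite ge0_integralZl_EFin//.
  - by rewrite (EFinM (16 * b0 ^+ 2)) lee_wpmul2l ?lee_fin//; exact: integral_powR_half_sub_le.
  - by move=> x _; rewrite lee_fin powR_ge0.
  - by apply/measurable_EFinP; apply: measurable_funTS; exact: measurable_powR.
have GG_le : (\int[mu \x mu]_(w in D `*` D) ((g w.1)%:E + (g w.2)%:E) <=
    (32 * b0 ^+ 2 * (N `^ (3 / 2 + p) * E `^ r))%:E)%E.
  rewrite (ge0_integral_setX_add mu mD mg g0) [X in (X * _ *+ 2)%E]NE.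
  have -> : 32 * b0 ^+ 2 * (N `^ (3 / 2 + p) * E `^ r) =
      N * (16 * b0 ^+ 2 * (E `^ r * N `^ (2^-1 + p))) +
      N * (16 * b0 ^+ 2 * (E `^ r * N `^ (2^-1 + p))).
    rewrite -(@mulr_powRB1 _ N (3 / 2 + p)) ?addr_gt0//.
    by rewrite (_ : 3 / 2 + p - 1 = 2^-1 + p); [ring|field].
  by rewrite mule2n EFinD EFinM leeD// lee_wpmul2l ?lee_fin.
have GG_lty := le_lt_trans GG_le (ltry _).
apply: (@le_trans _ _ (\int[(mu \x mu)%E]_(w in D `*` D) (g w.1 + g w.2))).
  apply: le_Rintegral_nonmeasurable => //.
  - by move=> w [/g0 g1 /g0 g2]; rewrite addr_ge0 -?lee_fin.
  - move=> w [/Rge0P w1 /Rge0P w2]; rewrite -(Jop_phi_ext phi).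
    apply: (le_trans (Jop_reg_power_le kb p_gt0 p_le e_gt0 w1 w2)).
    rewrite -mulrDr ler_wpM2l// powR_subadditive//.
    by rewrite lerBlDr ler_wpDr ?invf_le1 ?ler1n// ltW.
rewrite -lee_fin fineK// ge0_fin_numE//.
by apply: integral_ge0 => w [/g0 g1 /g0 g2]; rewrite EFinD adde_ge0.
Qed.

End ProductTerms.

Section NegativeMoment.
Variables (R : realType) (p : R).
Hypothesis p_gt0 : 0 < p.
Local Notation D := (@Rge0 R).

Lemma powq_ge0 (r x : R) : (0 <= powq r x)%E.
Proof. by rewrite /powq; case: ifP => // _; rewrite lee_fin powR_ge0. Qed.

Lemma Mq_ge0 (r : R) (mu : {measure set R -> \bar R}) : (0 <= Mq r mu)%E.
Proof. by apply: integral_ge0 => x _; exact: powq_ge0. Qed.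

Lemma reg_power_le_powq e x : 0 < e -> 0 <= x -> ((reg_power p e x)%:E <= powq (- p) x)%E.
Proof.
move=> e0 x0; rewrite /powq oppr_lt0 p_gt0 andbT; case: eqVneq => [_|xn0]; first exact: leey.
by rewrite lee_fin; apply: le_powRN; rewrite ?lerDl ?lt0r ?xn0// ltW.
Qed.

Lemma reg_power_le_shift e e' x : 0 < e -> e <= e' -> 0 <= x ->
  reg_power p e' x <= reg_power p e x.
Proof.
by move=> e0 ee' x0; apply: le_powRN; rewrite ?lerD2l ?ltr_wpDl// ltW.
Qed.

Lemma cvg_reg_power x : 0 <= x ->
  (reg_power p n.+1%:R^-1 x)%:E @[n --> \oo] --> powq (- p) x.
Proof.
rewrite le_eqVlt => /predU1P[<-|x0]; rewrite /powq oppr_lt0 p_gt0 andbT.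
  rewrite eqxx; apply/cvgeyPge => A; near=> n.
  rewrite lee_fin /reg_power add0r -[n.+1%:R^-1]powR_inv1// -powRrM mulN1r opprK.
  apply: (@le_trans _ _ ((`|A| `^ p^-1) `^ p)).
    by rewrite -powRrM mulVf ?gt_eqF// powRr1// ler_norm.
  apply: ge0_ler_powR; rewrite ?nnegrE ?powR_ge0 ?(ltW p_gt0)//.
  apply: (@le_trans _ _ n%:R); last by rewrite ler_nat.
  by near: n; exact: nbhs_infty_ger.
rewrite gt_eqF//; apply: cvg_EFin; first by near=> n.
have cx : (x + n.+1%:R^-1) @[n --> \oo] --> x.
  rewrite -[X in _ --> X]addr0; apply: cvgD; first exact: cvg_cst.
  exact: (@cvg_harmonic R).
exact: (cvg_comp _ _ cx (is_derive_continuous (is_derive1_powR (- p) x0))).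
Unshelve. all: by end_near.
Qed.

Lemma cvg_integral_reg_power (mu : {measure set R -> \bar R}) :
  (\int[mu]_(x in D) (reg_power p n.+1%:R^-1 x)%:E)%E @[n --> \oo] --> Mq (- p) mu.
Proof.
have inv_gt0 n : 0 < n.+1%:R^-1 :> R by rewrite invr_gt0.
rewrite (_ : Mq (- p) mu =
    \int[mu]_(x in D) limn (fun n => (reg_power p n.+1%:R^-1 x)%:E))%E; last first.
  by apply: eq_integral => x /set_mem/Rge0P x0; exact/esym/cvg_lim/cvg_reg_power.
apply: (cvg_monotone_convergence (mu := mu) (measurable_itv _)).
- move=> n; apply/measurable_EFinP; apply: measurable_funTS; exact: measurable_reg_power.
- by move=> n x _; rewrite lee_fin reg_power_ge0.
- move=> x /Rge0P x0 n m nm; rewrite lee_fin reg_power_le_shift//.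
  by rewrite lef_pV2 ?posrE// ler_nat.
Qed.

End NegativeMoment.

Section Solution.
Variables (R : realType) (p b0 eta : R) (phi k dk : R -> R).
Variable F : R -> {finite_measure set R -> \bar R}.
Hypotheses (p_gt0 : 0 < p) (p_le : p <= 2^-1).
Hypothesis phiP : kernel_assumption phi b0 eta k dk.
Hypothesis eta_ge : 1 + p <= eta.
Hypothesis FP : is_solution phi F.
Local Notation D := (@Rge0 R).
Let N : R := fine (Nmass (F 0)).
Let E : R := fine (Energy (F 0)).

Lemma NmassE (mu : {finite_measure set R -> \bar R}) : Nmass mu = mu D.
Proof.
have mD : measurable D by exact: measurable_itv.
rewrite /Nmass /Mq; under eq_integral do rewrite /powq ltxx andbF powRr0.
by rewrite (integral_cst _ mD 1%E) mul1e.
Qed.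

Lemma EnergyE (mu : {finite_measure set R -> \bar R}) :
  Energy mu = (\int[mu]_(x in D) x%:E)%E.
Proof.
rewrite /Energy /Mq; apply: eq_integral => x /set_mem/Rge0P x0.
by rewrite /powq [_ < 0]ltNge ler01 andbF powRr1.
Qed.

Lemma mass_conserved t : 0 <= t -> fine (F t D) = N.
Proof. by move=> t0; have [_ [/(_ t t0)[NF _] _]] := FP; rewrite -NmassE NF. Qed.

Lemma energy_conserved t : 0 <= t -> \int[F t]_(x in D) x = E.
Proof.
by move=> t0; have [_ [/(_ t t0)[_ EF] _]] := FP; rewrite /Rintegral -EnergyE EF.
Qed.

Lemma energy_lty t : 0 <= t -> (\int[F t]_(x in D) x%:E < +oo)%E.
Proof.
move=> t0; have [/(_ t t0)[_ B1] _] := FP; apply: le_lt_trans B1.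
by apply: ge0_le_integral_nonmeasurable => x /Rge0P x0; rewrite lee_fin ?lerDr.
Qed.

Let a : R := 8 ^+ 2 * b0 ^+ 2 * N `^ (3 / 2 + p) * E `^ (2^-1 - p)
           + 8 `^ (2 + eta) * b0 ^+ 2 * N ^+ 3.
Let b : R := 8 `^ (3 + eta) * b0 ^+ 2 * N ^+ 2 * (1 + q1 k dk).

Let N_ge0 : 0 <= N.
Proof. by rewrite /N NmassE fine_ge0. Qed.

Lemma quadratic_rate_le : 32 * b0 ^+ 2 * (N `^ (3 / 2 + p) * E `^ (2^-1 - p)) <= a.
Proof.
apply: ler_wpDr.
  exact: mulr_ge0 (mulr_ge0 (powR_ge0 _ _) (sqr_ge0 _)) (exprn_ge0 _ N_ge0).
rewrite -[leRHS]mulrA; apply: ler_wpM2r; first exact: mulr_ge0 (powR_ge0 _ _) (powR_ge0 _ _).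
by rewrite ler_wpM2r ?sqr_ge0// -natrX ler_nat.
Qed.

Lemma cubic_rate_le : 256 * (b0 ^+ 2 * (1 + q1 k dk)) * N ^+ 2 <= b.
Proof.
have c0 : 0 <= b0 ^+ 2 * (1 + q1 k dk) * N ^+ 2.
  by rewrite mulr_ge0 ?sqr_ge0// mulr_ge0 ?sqr_ge0// addr_ge0// (q1_ge0 phiP).
have le_8 : 256 <= 8 `^ (3 + eta) :> R.
  apply: (@le_trans _ _ (8 `^ 3%:R)); first by rewrite powR_mulrn//; lra.
  rewrite ler_powR ?ler1n// lerDl; have := p_gt0; have := eta_ge; lra.
by have := ler_wpM2r c0 le_8; rewrite /b; lra.
Qed.

Lemma integral_reg_power_le e t : 0 < e -> 0 <= t ->
  \int[F t]_(x in D) reg_power p e x <=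
    (a * t + \int[F 0]_(x in D) reg_power p e x) * expR (b * t).
Proof.
move=> e0 t0; have [_ [_ /(_ _ (reg_power_C11b p_gt0 e0))[dG _]]] := FP.
have a0 : 0 <= a.
  apply: le_trans quadratic_rate_le.
  apply: mulr_ge0; first by rewrite mulr_ge0 ?sqr_ge0.
  exact: mulr_ge0 (powR_ge0 _ _) (powR_ge0 _ _).
have b_ge0 : 0 <= b.
  apply: mulr_ge0; last by rewrite addr_ge0 ?(q1_ge0 phiP).
  exact: mulr_ge0 (mulr_ge0 (powR_ge0 _ _) (sqr_ge0 _)) (sqr_ge0 _).
apply: (gronwall_within a0 b_ge0 dG) t0 => {}t t0 /=; apply: lerD.
- apply: le_trans quadratic_rate_le.
  have := quadratic_term_le phiP p_gt0 p_le e0 (energy_lty t0).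
  by rewrite (mass_conserved t0) (energy_conserved t0) => /le_trans; apply.
- have := cubic_term_le phiP p_gt0 p_le e0 (F t); rewrite (mass_conserved t0) mulrA.
  move=> /le_trans; apply; apply: ler_wpM2r cubic_rate_le.
  by apply: Rintegral_ge0 => x _; exact: reg_power_ge0.
Qed.

Lemma Mq_le (t : R) : 0 <= t -> (Mq (- p) (F 0) < +oo)%E ->
  (Mq (- p) (F t) <= ((a * t)%:E + Mq (- p) (F 0)) * (expR (b * t))%:E)%E.
Proof.
move=> t0 M0_lty.
have cvg_Mq := @cvg_integral_reg_power _ _ p_gt0 (F t).
rewrite -(cvg_lim _ cvg_Mq)//; apply: lime_le; first by apply/cvg_ex; exists (Mq (- p) (F t)).
near=> n; set e := n.+1%:R^-1; have e_gt0 : 0 < e by rewrite invr_gt0.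
have int_fin s : ((\int[F s]_(x in D) (reg_power p e x)%:E) \is a fin_num)%E.
  rewrite ge0_fin_numE; first exact: integral_reg_power_lty p_gt0 e_gt0 (F s).
  by apply: integral_ge0 => x _; rewrite lee_fin reg_power_ge0.
rewrite -(fineK (int_fin t)).
apply: (@le_trans _ _ ((a * t + \int[F 0]_(x in D) reg_power p e x) * expR (b * t))%:E).
  by rewrite lee_fin; exact: integral_reg_power_le e_gt0 t0.
rewrite EFinM lee_wpmul2r ?lee_fin ?expR_ge0// EFinD; apply: leeD; first exact: lexx.
rewrite /Rintegral (fineK (int_fin 0)).
apply: ge0_le_integral_nonmeasurable => x /Rge0P x0; first by rewrite lee_fin reg_power_ge0.
exact: reg_power_le_powq.
Unshelve. all: by end_near.
Qed.

End Solution.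

Theorem theorem2p1 (R : realType) (p b0 eta : R) (phi k dk : R -> R)
    (F : R -> {finite_measure set R -> \bar R}) :
  0 < p <= 2^-1 ->
  kernel_assumption phi b0 eta k dk ->
  1 + p <= eta ->
  (Mq (- p)%R (F 0%R) < +oo)%E ->
  is_solution phi F ->
  let N := fine (Nmass (F 0)) in
  let E := fine (Energy (F 0)) in
  let a := 8 ^+ 2 * b0 ^+ 2 * N `^ (3 / 2 + p) * E `^ (2^-1 - p)
           + 8 `^ (2 + eta) * b0 ^+ 2 * N ^+ 3 in
  let b := 8 `^ (3 + eta) * b0 ^+ 2 * N ^+ 2 * (1 + q1 k dk) in
  (forall t, 0 < t -> (Mq (- p)%R (F t) < +oo)%E) /\
  (forall t, 0 <= t ->
     (Mq (- p)%R (F t) <= ((a * t)%:E + Mq (- p)%R (F 0%R)) * (expR (b * t))%:E)%E).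
Proof.
move=> /andP[p_gt0 p_le] phiP eta_ge M0_lty FP N E a b.
have bound t : 0 <= t ->
    (Mq (- p)%R (F t) <= ((a * t)%:E + Mq (- p)%R (F 0%R)) * (expR (b * t))%:E)%E.
  by move=> t0; exact: (Mq_le p_gt0 p_le phiP eta_ge FP t0 M0_lty).
split=> // t /ltW t0; apply: (le_lt_trans (bound t t0)).
have M0_fin : Mq (- p)%R (F 0%R) \is a fin_num by rewrite ge0_fin_numE// Mq_ge0.
by rewrite -(fineK M0_fin) -EFinD -EFinM ltry.
Qed.
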